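(* Let $K$ be a finite field, and $F$ a quadratic extension field of the rational function field $K(x)$ over $K$. Denote the integral closure of $K[x]$ in $F$ by $\mathcal{O}_F$. Then the following two statements are equivalent. (a) $u(\mathcal{O}_F) = \omega$. (b) The function field $F \mid K$ has full constant field $K$ and genus $0$, and the infinite place of $K(x)$ splits into two places of $F \mid K$.
   Context: The full constant field of a function field $F \mid K$ is the algebraic closure of $K$ in $F$. The infinite place of $K(x)$ is the place corresponding to the valuation $v_\infty(f/g) = \deg g - \deg f$ for $f, g \in K[x]$, $g \neq 0$. The quadratic extension $F$ of $K(x)$ is not assumed to be separable. Unit sum number: let $R$ be a ring with identity and $k$ a positive integer. An element $r \in R$ is $k$-good if there are units $e_1, \ldots, e_k$ of $R$ with $r = e_1 + \cdots + e_k$. The ring $R$ is $k$-good if every element of $R$ is $k$-good. The unit sum number is $u(R) := \min\{k \mid R \text{ is } k\text{-good}\}$ if this minimum exists; if it does not exist but $R$ is additively generated by its units, then $u(R) := \omega$; if the units do not generate $R$ additively, then $u(R) := \infty$. *)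

(* Defs.v *)
From HB Require Import structures.
From mathcomp Require Import all_boot all_order all_algebra all_field.
From mathcomp Require Import boolp classical_sets functions cardinality fsbigop.

Set Implicit Arguments.
Unset Strict Implicit.
Unset Printing Implicit Defensive.

Import Order.TTheory GRing.Theory Num.Theory.

Local Open Scope classical_set_scope.
Local Open Scope ring_scope.

Section UnitSumNumber.
Variable R : pzRingType.

Definition is_unit (e : R) : Prop := exists f : R, e * f = 1 /\ f * e = 1.

Definition good_elt (k : nat) (r : R) : Prop :=
  exists e : 'I_k -> R, (forall i, is_unit (e i)) /\ r = \sum_(i < k) e i.

Definition good_ring (k : nat) : Prop := forall r : R, good_elt k r.

Definition generated_by_units : Prop :=
  forall S : {pred R}, zmod_closed S ->
    (forall e, is_unit e -> e \in S) -> forall r, r \in S.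

End UnitSumNumber.

Inductive usn_value : Type := UsnFin of nat | UsnOmega | UsnInfty.

Definition unit_sum_number (R : pzRingType) : usn_value :=
  match pselect (exists k, `[< (0 < k)%N /\ good_ring R k >]) with
  | left ex_good => UsnFin (ex_minn ex_good)
  | right _ =>
      if `[< generated_by_units R >] then UsnOmega else UsnInfty
  end.

Section IntegralClosure.
Variables (A : comNzRingType) (E : fieldType) (f : {rmorphism A -> E}).

Definition integral_pred : {pred E} := [pred z | `[< integralOver f z >]].

Lemma integral_pred_subring : subring_closed integral_pred.
Proof.
split=> [|x y /asboolP ix /asboolP iy|x y /asboolP ix /asboolP iy];
  apply/asboolP.
- exact: integral1.
- exact: integral_sub.
- exact: integral_mul.
Qed.

HB.instance Definition _ :=
  GRing.isSubringClosed.Build E integral_pred integral_pred_subring.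

Record integral_closure : Type :=
  IntegralClosure { ic_val :> E; _ : ic_val \in integral_pred }.

HB.instance Definition _ := [isSub for ic_val].
HB.instance Definition _ := [Choice of integral_closure by <:].
HB.instance Definition _ :=
  [SubChoice_isSubComNzRing of integral_closure by <:].

End IntegralClosure.

(* Function fields E | K, given by the embedding iota of K into E. *)
Section FunctionField.
Variables (K E : fieldType) (iota : {rmorphism K -> E}).

Definition full_constant_field : Prop :=
  forall z : E, algebraicOver iota z -> exists c : K, z = iota c.

(* A valuation ring of E | K: a ring O with K < O < E (strict inclusions)
   containing z or z^-1 for every z in E. *)
Definition is_valuation_ring (O : set E) : Prop :=
  [/\ [/\ O 1, forall a b, O a -> O b -> O (a - b)
         & forall a b, O a -> O b -> O (a * b)],
      range iota `<` O, O `<` setT & forall z, O z \/ O z^-1].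

(* A place is the maximal ideal of a valuation ring of E | K.  The ideal and
   the ring determine each other, and the record carries the ring. *)
Record place : Type :=
  Place { vring : set E; vringP : is_valuation_ring vring }.

HB.instance Definition _ := gen_eqMixin place.
HB.instance Definition _ := gen_choiceMixin place.

Definition vunits (P : place) : set E :=
  [set z | z != 0 /\ vring P z /\ vring P z^-1].

Definition videal (P : place) : set E := vring P `\` vunits P.

Definition prime_elt (P : place) (t : E) : Prop :=
  videal P = [set t * a | a in vring P].

(* The normalised discrete valuation of P at z != 0: the n such that
   z = t ^ n * u with t a prime element and u a unit of the valuation ring.
   The value at z = 0 is meaningless and never used. *)
Definition val_at (P : place) (z : E) : int :=
  xget 0 [set n : int | exists t u,
    [/\ prime_elt P t, vunits P u & z = t ^ n * u]].

(* The n vectors b i lie in V and induce a K-basis of V / (V `&` W). *)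
Definition is_quot_basis (V W : set E) (n : nat) (b : 'I_n -> E) : Prop :=
  [/\ forall i, V (b i),
      forall c : 'I_n -> K, W (\sum_(i < n) iota (c i) * b i) ->
        forall i, c i = 0
    & forall z, V z ->
        exists c : 'I_n -> K, W (z - \sum_(i < n) iota (c i) * b i)].

Definition quot_dim (V W : set E) : nat :=
  xget 0%N [set n | exists b : 'I_n -> E, is_quot_basis V W b].

Definition place_degree (P : place) : nat := quot_dim (vring P) (videal P).

Record divisor : Type := Divisor {
  div_coef :> place -> int;
  div_finite : finite_set [set P | div_coef P != 0] }.

Definition div_degree (D : divisor) : int :=
  \sum_(P \in [set: place]) D P * (place_degree P)%:Z.

Definition riemann_roch_space (D : divisor) : set E :=
  [set z | z != 0 -> forall P, - D P <= val_at P z].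

Definition div_ell (D : divisor) : nat :=
  quot_dim (riemann_roch_space D) [set 0].

(* K need not be algebraically closed in E here; the genus is taken over K. *)
Definition has_genus (g : nat) : Prop :=
  (exists D : divisor, div_degree D - (div_ell D)%:Z + 1 = g%:Z) /\
  (forall D : divisor, div_degree D - (div_ell D)%:Z + 1 <= g%:Z).

End FunctionField.

Section InfinitePlace.
Variable K : fieldType.

Definition ratfun_const : {rmorphism K -> {fraction {poly K}}} :=
  @tofrac {poly K} \o polyC.

(* The fractions f / g with 0 <= v_oo (f / g) = deg g - deg f, or f = 0. *)
Definition infinite_ring : set {fraction {poly K}} :=
  [set z | exists f g : {poly K},
    [/\ g != 0, (size f <= size g)%N & z = tofrac f / tofrac g]].

Lemma fraction_numden (z : {fraction {poly K}}) :
  exists f g : {poly K}, g != 0 /\ z = tofrac f / tofrac g.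
Proof.
elim/quotW: z => x; exists (frac x).1, (frac x).2.
have dx : (frac x).2 != 0 := denom_ratioP x.
split=> //; apply: (canRL (mulfK _)); first by rewrite tofrac_eq0.
unlock tofrac; rewrite -[LHS]FracField.pi_mul /FracField.mulf.
apply/eqmodP; rewrite /= FracField.equivfE.
by rewrite !numden_Ratio ?mulf_neq0 ?oner_eq0 // !mulr1 mulrC.
Qed.

Lemma infinite_ringP : is_valuation_ring ratfun_const infinite_ring.
Proof.
have tf0 (g : {poly K}) : g != 0 -> tofrac g != 0 by rewrite tofrac_eq0.
have X0 : ('X : {poly K}) != 0 by rewrite polyX_eq0.
have le_mul (p q f g : {poly K}) : q != 0 -> g != 0 ->
    (size p <= size q)%N -> (size f <= size g)%N ->
    (size (p * f)%R <= size (q * g)%R)%N.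
  move=> q0 g0 pq fg; rewrite (size_mul q0 g0).
  apply: leq_trans (size_polyMleq p f) _.
  by rewrite -!subn1 leq_sub2r // leq_add.
have subf_div (L : fieldType) (a b c d : L) : b != 0 -> d != 0 ->
    a / b - c / d = (a * d - c * b) / (b * d).
  by move=> b0 d0; rewrite -mulNr addf_div // mulNr.
split; first split.
- by exists 1, 1; rewrite oner_eq0 divff ?tofrac_eq0 ?oner_eq0.
- move=> _ _ [f1 [g1 [g10 s1 ->]]] [f2 [g2 [g20 s2 ->]]].
  exists (f1 * g2 - f2 * g1), (g1 * g2); split; first by rewrite mulf_neq0.
    apply: leq_trans (size_polyD _ _) _; rewrite size_polyN geq_max.
    by rewrite le_mul // [g1 * g2]mulrC le_mul.
  by rewrite tofracB !tofracM subf_div ?tf0.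
- move=> _ _ [f1 [g1 [g10 s1 ->]]] [f2 [g2 [g20 s2 ->]]].
  exists (f1 * f2), (g1 * g2); split; [by rewrite mulf_neq0 | exact: le_mul |].
  by rewrite !tofracM mulf_div.
- split.
    move=> _ [c _ <-]; exists c%:P, 1; split; first by rewrite oner_eq0.
      by rewrite size_poly1 size_polyC_leq1.
    by rewrite tofrac1 divr1.
  move=> /(_ (tofrac 1 / tofrac 'X)) [].
    by exists 1, 'X; rewrite X0 size_poly1 size_polyX.
  move=> c _ /= /(canLR (divfK (tf0 _ X0))) /eqP.
  rewrite -tofracM tofrac_eq => /eqP /(congr1 (fun p : {poly K} => p`_0)).
  by rewrite coefMX coef1 => /eqP; rewrite eq_sym oner_eq0.
- split=> // /(_ (tofrac 'X) I) [f [g [g0 sfg]]].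
  move=> /(canLR (divfK (tf0 _ g0))) /eqP.
  rewrite -tofracM tofrac_eq => /eqP fE; move: sfg.
  by rewrite -fE mulrC size_mulX // ltnn.
- move=> z; have [f [g [g0 ->]]] := fraction_numden z.
  case: (leqP (size f) (size g)) => sfg; first by left; exists f, g.
  right; exists g, f; rewrite invf_div (ltnW sfg); split=> //.
  by rewrite -size_poly_gt0 (leq_ltn_trans _ sfg).
Qed.

Definition infinite_place : place ratfun_const := Place infinite_ringP.

End InfinitePlace.

Section Extension.
Variables (K : fieldType) (F : fieldExtType {fraction {poly K}}).

Definition ext_const : {rmorphism K -> F} := in_alg F \o ratfun_const K.

Definition ring_of_integers : comNzRingType :=
  integral_closure (in_alg F \o @tofrac {poly K}).

Definition lies_over (Q : place ext_const) (P : place (ratfun_const K)) : Prop :=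
  in_alg F @` videal P `<=` videal Q.

Definition splits_into_two (P : place (ratfun_const K)) : Prop :=
  ([set Q : place ext_const | lies_over Q P] #= `I_2)%card.

End Extension.

(* Main.v *)
Require Import Defs.
From mathcomp Require Import all_boot all_order all_algebra all_field.
From mathcomp Require Import boolp classical_sets functions cardinality fsbigop.
From mathcomp Require Import ring zify.
From HB Require Import structures.

(* Let x be the variable of K(x) and call a place of F infinite when x is not in its valuation
   ring.  If P and Q are two distinct infinite places, then both are unramified over K(x) with
   residue field K, and there is no third one; an integral element without pole at P and Q is then
   constant, because an element lying in every valuation ring of F | K is algebraic over K
   (Chevalley).

   Both statements are equivalent to the existence of integral elements z, z' such that z has a
   simple pole at P and a zero at Q, and z' a simple pole at Q and a zero at P.  Given such z, z',
   the product z z' is a nonzero constant, and removing poles term by term gives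
   O_F = K[z, 1/z] and F = K(z); so the units are the c z^n, the genus is 0, and a sum of k units
   has at most k terms.

   If the units generate O_F, a nonconstant unit provides P and Q; all units are then c e^n for a
   single unit e, and x, being a K-combination of powers of e with a simple pole at P, forces the
   pole of e at P to be simple.  If the genus is 0, then z and z' are found in the Riemann-Roch
   spaces of P - Q and Q - P, which have degree 0. *)

Set Implicit Arguments.
Unset Strict Implicit.
Unset Printing Implicit Defensive.

Import Order.TTheory GRing.Theory Num.Theory.

Local Open Scope classical_set_scope.
Local Open Scope ring_scope.

(** * Valuation rings *)

(** What is needed about P and Q is drawn from linear relations over K(x). In a relation between
    z^2, z and 1 two terms have the same value, which bounds the ramification. An element e that is
    1 at P and 0 at Q gives a basis e, 1 - e of F over K(x) whose coordinates show regularity at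
    infinity; this works because an element of K(x) is regular, or vanishes, at all infinite places
    or at none. A place is an arbitrary valuation ring, so nothing is discrete by definition,
    whereas Riemann-Roch spaces are written with [val_at], which is meaningful only at discrete
    places. Discreteness is therefore proved for each kind of place: x^-1 is a uniformizer at P and
    Q, and at a finite place either a polynomial in x or a square root of one up to a unit. The
    genus of K(z) comes from an explicit basis of every Riemann-Roch space of nonnegative degree. *)

Section ValuationRing.
Variables (K E : fieldType) (iota : {rmorphism K -> E}).
Implicit Types (P Q : place iota) (z a b u t : E).

Lemma place_inj P Q : vring P = vring Q -> P = Q.
Proof.
by case: P Q => [O hO] [O' hO'] /= e; case: _ / e hO' => hO'; rewrite (Prop_irrelevance hO hO').
Qed.

Lemma vring1 P : vring P 1. Proof. by case: (vringP P) => -[]. Qed.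

Lemma vringB P a b : vring P a -> vring P b -> vring P (a - b).
Proof. by case: (vringP P) => -[_ h _] _ _ _; exact: h. Qed.

Lemma vringM P a b : vring P a -> vring P b -> vring P (a * b).
Proof. by case: (vringP P) => -[_ _ h] _ _ _; exact: h. Qed.

Lemma vring0 P : vring P 0.
Proof. by rewrite -(subrr 1); apply: vringB; exact: vring1. Qed.

Lemma vringN P a : vring P a -> vring P (- a).
Proof. by rewrite -sub0r; apply: vringB; exact: vring0. Qed.

Lemma vringD P a b : vring P a -> vring P b -> vring P (a + b).
Proof. by move=> ha hb; rewrite -[b]opprK; apply/vringB/vringN. Qed.

Lemma vringX P a n : vring P a -> vring P (a ^+ n).
Proof.
by move=> ha; elim: n => [|n IH]; rewrite ?expr0 ?exprS; [exact: vring1 | exact: vringM].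
Qed.

Lemma vring_const P c : vring P (iota c).
Proof. by case: (vringP P) => _ [h _] _ _; apply: h; exists c. Qed.

Lemma vring_total P z : vring P z \/ vring P z^-1.
Proof. by case: (vringP P) => _ _ _; exact. Qed.

Lemma vring_proper P : exists z, ~ vring P z.
Proof.
case: (vringP P) => _ _ [_ h] _; apply/existsNP => h'; apply: h => z _; exact: h'.
Qed.

Lemma vring_sum P (I : Type) (r : seq I) (p : pred I) (f : I -> E) :
  (forall i, p i -> vring P (f i)) -> vring P (\sum_(i <- r | p i) f i).
Proof. by move=> h; elim/big_ind: _ => //; [exact: vring0 | exact: vringD]. Qed.

(** The working form of the maximal ideal: as the ring contains z or its inverse, only the inverse
    has to be inspected. *)
Lemma videalP P z : videal P z <-> z = 0 \/ ~ vring P z^-1.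
Proof.
rewrite /videal /vunits /setD /=; split.
  move=> [hz hn]; case: (eqVneq z 0) => [|z0]; [by left | right => hV].
  by apply: hn.
case=> [-> | hV]; first by split; [exact: vring0 | rewrite eqxx => -[]].
by split=> [|[_ []]//]; case: (vring_total P z).
Qed.

Lemma videal_vring P z : videal P z -> vring P z. Proof. by case. Qed.

Lemma videal0 P : videal P 0. Proof. by apply/videalP; left. Qed.

Lemma videalV P z : ~ vring P z -> videal P z^-1.
Proof. by move=> h; apply/videalP; right; rewrite invrK. Qed.

Lemma videal1 P : ~ videal P 1.
Proof. by move=> /videalP [/eqP|]; rewrite ?oner_eq0 // invr1; case; exact: vring1. Qed.

Lemma videal_vringV P z : z != 0 -> videal P z -> ~ vring P z^-1.
Proof. by move=> z0 /videalP [/eqP|//]; rewrite (negPf z0). Qed.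

Lemma videalM P a b : videal P a -> vring P b -> videal P (a * b).
Proof.
move=> ha hb; apply/videalP; case: (eqVneq (a * b) 0) => [|ab0]; [by left|right=> h].
move: ab0; rewrite mulf_eq0 negb_or => /andP [a0 b0].
apply: (videal_vringV a0 ha).
by rewrite (_ : a^-1 = b * (a * b)^-1); [exact: vringM | field; rewrite a0 b0].
Qed.

Lemma videalMr P a b : vring P a -> videal P b -> videal P (a * b).
Proof. by move=> ha hb; rewrite mulrC; exact: videalM. Qed.

Lemma videalN P a : videal P a -> videal P (- a).
Proof. by move=> h; rewrite -mulrN1; apply: (videalM h); apply/vringN/vring1. Qed.

Lemma videalD P a b : videal P a -> videal P b -> videal P (a + b).
Proof.
wlog hab : a b / vring P (a / b).
  move=> hw ha hb; case: (vring_total P (a / b)) => [h|]; first exact: hw.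
  by rewrite invf_div => h; rewrite addrC; exact: hw.
move=> ha hb; case: (eqVneq b 0) => [->|b0]; first by rewrite addr0.
rewrite (_ : a + b = b * (a / b + 1)); last by field.
by apply: (videalM hb); apply: vringD => //; exact: vring1.
Qed.

Lemma videalB P a b : videal P a -> videal P b -> videal P (a - b).
Proof. by move=> ha hb; apply/videalD/videalN. Qed.

Lemma videal_sum P (I : Type) (r : seq I) (p : pred I) (f : I -> E) :
  (forall i, p i -> videal P (f i)) -> videal P (\sum_(i <- r | p i) f i).
Proof. by move=> h; elim/big_ind: _ => //; [exact: videal0 | exact: videalD]. Qed.

Lemma videalXn P a n : videal P a -> (0 < n)%N -> videal P (a ^+ n).
Proof.
by case: n => // n h _; rewrite exprS; apply: videalM => //; apply/vringX/videal_vring.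
Qed.

Lemma vunits_neq0 P u : vunits P u -> u != 0. Proof. by case. Qed.
Lemma vunits_vring P u : vunits P u -> vring P u. Proof. by case=> _ []. Qed.
Lemma vunitsV P u : vunits P u -> vunits P u^-1.
Proof. by case=> u0 [h h']; split; rewrite ?invr_eq0 ?invrK. Qed.
Lemma vunits1 P : vunits P 1.
Proof. by split; rewrite ?oner_eq0 ?invr1 //; split; exact: vring1. Qed.
Lemma vunitsM P a b : vunits P a -> vunits P b -> vunits P (a * b).
Proof.
by case=> a0 [ha ha'] [b0 [hb hb']]; split; [rewrite mulf_neq0|rewrite invfM; split; exact: vringM].
Qed.
Lemma vunitsP P u : vunits P u <-> vring P u /\ ~ videal P u.
Proof.
split=> [h|[h h']]; first by split; [exact: vunits_vring | case].
by apply: contrapT => h2; apply: h'.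
Qed.

Lemma vunits_expz P u (n : int) : vunits P u -> vunits P (u ^ n).
Proof.
have X k v : vunits P v -> vunits P (v ^+ k).
  by move=> h; elim: k => [|k IH]; rewrite ?expr0 ?exprS; [exact: vunits1|exact: vunitsM].
by move=> h; case: n => n; [exact: X | rewrite NegzE -exprnN; apply/vunitsV/X].
Qed.

Lemma vunits_const P c : c != 0 -> vunits P (iota c).
Proof.
by move=> c0; split; rewrite ?fmorph_eq0 -?fmorphV //; split; exact: vring_const.
Qed.

Lemma videal_const P c : videal P (iota c) -> c = 0.
Proof.
move=> h; apply/eqP; apply: contrapT => /negP c0.
by have /vunitsP [_] := vunits_const P c0.
Qed.

Lemma vunitsD P u a : vunits P u -> videal P a -> vunits P (u + a).
Proof.
move=> hu ha; apply/vunitsP; split.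
  by apply: vringD; [exact: vunits_vring | exact: videal_vring].
move=> h; have /vunitsP [_] := hu; apply.
by rewrite -(addrK a u); apply: videalB.
Qed.

(* At a pole t of P a polynomial behaves like its leading term. *)
Lemma horner_pole P t (p : {poly E}) : ~ vring P t ->
  (forall i, vring P p`_i) ->
  videal P (p.[t] / t ^+ (size p).-1 - lead_coef p).
Proof.
move=> ht hp; have t0 : t != 0 by apply: contra_not_neq ht => ->; exact: vring0.
case: (posnP (size p)) => [/eqP|sp]; first by rewrite size_poly_eq0 => /eqP ->;
  rewrite horner0 lead_coef0 mul0r subrr; exact: videal0.
rewrite horner_coef /lead_coef; case: (size p) sp => // n _.
rewrite big_ord_recr /= mulrDl mulfK ?expf_neq0 // addrK mulr_suml.
apply: videal_sum => i _; rewrite -mulrA; apply: videalMr => //.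
case: i => i /= lin; rewrite -(subnKC (ltnW lin)) exprD invfM mulrA divff ?expf_neq0 // mul1r.
by rewrite -exprVn; apply: videalXn; [exact: videalV | rewrite subn_gt0].
Qed.

(** Valuation rings are integrally closed: at a pole z, a monic equation divided by its leading
    power of z would put 1 into the maximal ideal. *)
Lemma vring_integral P (A : comNzRingType) (f : {rmorphism A -> E}) z :
  (forall c, vring P (f c)) -> integralOver f z -> vring P z.
Proof.
move=> hf [p mp]; apply: contraPP => hz /rootP pz.
have := @horner_pole P z (map_poly f p) hz.
rewrite pz mul0r sub0r (monicP (monic_map f mp)) => h.
apply: (@videal1 P); rewrite -[1]opprK; apply/videalN/h => i.
by rewrite coef_map; exact: hf.
Qed.

End ValuationRing.

(** * Discrete places and their normalised valuations *)

Section DiscretePlace.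
Variables (K E : fieldType) (iota : {rmorphism K -> E}).
Implicit Types (P Q : place iota) (z a b u t : E).

(** A prime element alone does not make a valuation ring discrete: the maximal ideal can be
    principal in higher rank. Hence the factorisation is part of the notion. *)
Definition uniformizer P t : Prop :=
  videal P t /\ forall z, z != 0 -> exists n u, vunits P u /\ z = t ^ n * u.

Definition discrete_place P : Prop := exists t, uniformizer P t.

Lemma uniformizer_neq0 P t : uniformizer P t -> t != 0.
Proof.
case=> _ h; apply/eqP => t0; have [z hz] := vring_proper P.
have z0 : z != 0 by apply: contra_not_neq hz => ->; exact: vring0.
have [n [u [hu E1]]] := h z z0; apply: hz; apply: vunits_vring.
(* [0 ^ n] is 0 for every nonzero n, negative ones included, so the nonzero z is the unit u. *)
move: z0; rewrite E1 t0 exp0rz; case: (n == 0); last by rewrite mul0r eqxx.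
by rewrite mul1r.
Qed.

Lemma vunits_expz_eq0 P t (n : int) : t != 0 -> videal P t -> vunits P (t ^ n) -> n = 0.
Proof.
move=> t0 ht; case: n => [[//|n]|n] hu; exfalso.
  by case/vunitsP: hu => _; apply; exact: videalXn.
have /vunitsP [_] := vunitsV hu; apply.
by rewrite NegzE -exprnN invrK; exact: videalXn.
Qed.

Lemma uniformizer_prime P t : uniformizer P t -> prime_elt P t.
Proof.
move=> ut; have t0 := uniformizer_neq0 ut; case: ut => ht h.
apply/seteqP; split=> [z hz|_ [a ha <-]] /=; last exact: videalM.
case: (eqVneq z 0) => [->|z0]; first by exists 0; rewrite ?mulr0; first exact: vring0.
have [n [u [hu E1]]] := h z z0.
case: n E1 => [[|n]|n] E1.
- by case/vunitsP: hu => _ []; rewrite -[u]mul1r -(expr0z t) -E1.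
- exists (t ^+ n * u); last by rewrite E1 mulrA -exprS.
  by apply: vringM; [apply/vringX/videal_vring | exact: vunits_vring].
- case/vunitsP: hu => _ []; rewrite (_ : u = z * t ^+ n.+1).
    by apply: videalM => //; apply/vringX/videal_vring.
  by rewrite E1 NegzE -exprnN mulrAC mulVf ?mul1r // expf_neq0.
Qed.

(** The exponent picked by [val_at] may belong to another prime element t', but t and t' generate
    the same ideal, so they differ by a unit, and a power of t that is a unit has exponent 0. *)
Lemma val_at_uniformizer P t u (n : int) :
  uniformizer P t -> vunits P u -> val_at P (t ^ n * u) = n.
Proof.
move=> ut hu; have t0 := uniformizer_neq0 ut; rewrite /val_at.
have pt := uniformizer_prime ut; case: xgetP => [m _|/(_ n) []]; last by exists t, u.
case=> t' [u' [pt' hu']].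
have [a ha E1] : [set t * a | a in vring P] t'.
  by rewrite -pt pt'; exists 1; rewrite ?mulr1; first exact: vring1.
have [b hb E2] : [set t' * a | a in vring P] t by rewrite -pt'; case: ut.
have ab1 : a * b = 1 by apply: (mulfI t0); rewrite mulrA E1 E2 mulr1.
have a0 : a != 0 by apply: contra_eq_neq ab1 => ->; rewrite mul0r eq_sym oner_neq0.
have ua : vunits P a.
  by split=> //; split=> //; rewrite (_ : a^-1 = b) //; apply: (mulfI a0); rewrite ab1 divff.
rewrite -E1 expfzMl => E3; apply/eqP; rewrite -subr_eq0; apply/eqP.
apply: (@vunits_expz_eq0 P t _ t0); first by case: ut.
rewrite (_ : t ^ (m - n) = u * (a ^ m * u')^-1).
  by apply: vunitsM => //; apply/vunitsV/vunitsM => //; exact: vunits_expz.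
have am0 : a ^ m * u' != 0 by rewrite mulf_neq0 ?expfz_neq0 // (vunits_neq0 hu').
apply: (canRL (mulfK am0)); apply: (mulfI (expfz_neq0 n t0)).
by rewrite E3 mulrA -expfzDr // addrC subrK mulrA.
Qed.

Section Valuation.
Variables (P : place iota) (dP : discrete_place P).

Lemma val_atP z : z != 0 ->
  exists t u, [/\ uniformizer P t, vunits P u & z = t ^ val_at P z * u].
Proof.
case: dP => t ut z0; have [n [u [hu E1]]] := (ut.2 z z0).
by exists t, u; split=> //; rewrite {2}E1 (val_at_uniformizer _ ut hu).
Qed.

Lemma val_atM a b : a != 0 -> b != 0 -> val_at P (a * b) = val_at P a + val_at P b.
Proof.
case: dP => t ut a0 b0; have t0 := uniformizer_neq0 ut.
have [n [u [hu ->]]] := ut.2 a a0; have [m [v [hv ->]]] := ut.2 b b0.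
rewrite mulrACA -expfzDr // !(val_at_uniformizer _ ut) //; exact: vunitsM.
Qed.

Lemma val_at_unit u : vunits P u -> val_at P u = 0.
Proof.
by case: dP => t ut hu; rewrite -[u]mul1r -(expr0z t) (val_at_uniformizer _ ut).
Qed.

Lemma val_atV a : a != 0 -> val_at P a^-1 = - val_at P a.
Proof.
move=> a0; have aV0 : a^-1 != 0 by rewrite invr_eq0.
have := val_atM aV0 a0; rewrite mulVf // (val_at_unit (vunits1 P)) => h.
by apply/eqP; rewrite -addr_eq0 -h.
Qed.

Lemma val_atX a n : a != 0 -> val_at P (a ^+ n) = val_at P a * n%:Z.
Proof.
move=> a0; elim: n => [|n IH].
  rewrite expr0 mulr0. by rewrite (val_at_unit (vunits1 P)).
by rewrite exprS val_atM ?expf_neq0 // IH -addn1 PoszD addrC mulrDr mulr1.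
Qed.

Lemma val_at_expz a (n : int) : a != 0 -> val_at P (a ^ n) = val_at P a * n.
Proof.
move=> a0; case: n => n; first exact: val_atX.
by rewrite NegzE -exprnN val_atV ?expf_neq0 // val_atX // mulrN.
Qed.

Lemma val_at_gt0 z : z != 0 -> (videal P z <-> 0 < val_at P z).
Proof.
move=> z0; have [t [u [[ht _] hu E1]]] := val_atP z0; split=> [hz|].
  rewrite ltNge; apply/negP => h; apply: (videal_vringV z0 hz).
  rewrite E1 invfM invr_expz; apply: vringM; last exact/vunits_vring/vunitsV.
  by case: (val_at P z) h => [[|n]|n] // _; apply/vringX/videal_vring.
rewrite E1 (_ : t ^ _ * u = z) //; case: (val_at P z) E1 => [[|n]|n] // -> _.
by apply: videalM; [exact: videalXn | exact: vunits_vring].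
Qed.

Lemma val_at_ge0 z : z != 0 -> (vring P z <-> 0 <= val_at P z).
Proof.
move=> z0; have := @val_at_gt0 z^-1; rewrite invr_eq0 val_atV // oppr_gt0 => /(_ z0) h.
rewrite leNgt; split=> [hz|/negP hz].
  by apply/negP => /h /(videal_vringV _); rewrite invr_eq0 invrK; apply.
by apply: contrapT => /videalV /h.
Qed.

Lemma val_at_eq0 z : z != 0 -> val_at P z = 0 -> vunits P z.
Proof.
move=> z0 hz; split=> //; split; apply/val_at_ge0; rewrite ?invr_eq0 //.
  by rewrite hz.
by rewrite val_atV // hz oppr0.
Qed.

Lemma val_at_prod (I : Type) (r : seq I) (p : pred I) (f : I -> E) :
  (forall i, p i -> f i != 0) ->
  val_at P (\prod_(i <- r | p i) f i) = \sum_(i <- r | p i) val_at P (f i).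
Proof.
move=> h; elim: r => [|i r IH]; first by rewrite !big_nil (val_at_unit (vunits1 P)).
rewrite !big_cons; case: ifP => // pi; rewrite val_atM ?h ?IH //.
by elim/big_ind: _ => // [|x y x0 y0]; [exact: oner_neq0 | exact: mulf_neq0].
Qed.

End Valuation.
End DiscretePlace.

(** * Chevalley's extension theorem *)

Section SubringType.
Variable E : fieldType.

Definition is_subring (B : set E) : Prop :=
  [/\ B 1, forall a b, B a -> B b -> B (a - b) & forall a b, B a -> B b -> B (a * b)].

Record subring_set : Type := SubringSet { carrier : set E; carrierP : is_subring carrier }.

Variable B : subring_set.

Definition subring_pred : {pred E} := [pred z | `[< carrier B z >]].

Lemma subring_pred_closed : subring_closed subring_pred.
Proof.
case: (carrierP B) => B1 BB BM.
by split=> [|x y /asboolP hx /asboolP hy|x y /asboolP hx /asboolP hy]; apply/asboolP; auto.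
Qed.

HB.instance Definition _ := GRing.isSubringClosed.Build E subring_pred subring_pred_closed.

(** [integralOver] speaks about a ring morphism, so a subring obtained as a set is turned into a
    ring type together with its inclusion. *)
Record subring_type : Type := SubringType { subring_val :> E; _ : subring_val \in subring_pred }.

HB.instance Definition _ := [isSub for subring_val].
HB.instance Definition _ := [Choice of subring_type by <:].
HB.instance Definition _ := [SubChoice_isSubComNzRing of subring_type by <:].

Definition subring_incl : {rmorphism subring_type -> E} := val.

Lemma subring_inclP (b : subring_type) : carrier B (subring_incl b).
Proof. by case: b => b /= /asboolP. Qed.

Lemma subring_incl_surj z : carrier B z -> exists b, subring_incl b = z.
Proof. by move=> /asboolP hz; exists (SubringType hz). Qed.

End SubringType.

Section Chevalley.
Variable E : fieldType.

Definition adjoin (A : comNzRingType) (f : {rmorphism A -> E}) (w : E) : set E :=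
  range (fun p : {poly A} => (map_poly f p).[w]).

Section Adjoin.
Variables (A : comNzRingType) (f : {rmorphism A -> E}).

Lemma adjoin_subring w : is_subring (adjoin f w).
Proof.
split=> [|_ _ [p _ <-] [q _ <-]|_ _ [p _ <-] [q _ <-]].
- by exists 1; rewrite // rmorph1 hornerC.
- by exists (p - q); rewrite // rmorphB !hornerE.
- by exists (p * q); rewrite // rmorphM !hornerE.
Qed.

Lemma adjoin_base w a : adjoin f w (f a).
Proof. by exists a%:P; rewrite // map_polyC hornerC. Qed.

Lemma adjoin_gen w : adjoin f w w.
Proof. by exists 'X; rewrite // map_polyX hornerX. Qed.

(* With v = (1, w, ..., w^N) and N large, both w^i * p(w) and w^i * q(1/w) stay in the A-span
   of v, so z is an eigenvalue of a matrix over A. *)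
Lemma integral_adjoin_inv (w z : E) :
  w != 0 -> adjoin f w z -> adjoin f w^-1 z -> integralOver f z.
Proof.
move=> w0 [p _ pz] [q _ qz]; set N := (size q + size p)%N.
pose R (i : nat) : {poly A} :=
  if (i < size q)%N then 'X^i * p else \poly_(j < i.+1) q`_(i - j).
have sR (i : 'I_N.+1) : (size (R i) <= N.+1)%N.
  rewrite /R; case: ltnP => hi; last exact: leq_trans (size_poly _ _) (ltn_ord i).
  apply: leq_trans (size_polyMleq _ _) _; rewrite size_polyXn addSn /=.
  by rewrite /N leqW // leq_add2r ltnW.
have Rz i : (map_poly f (R i)).[w] = w ^+ i * z.
  rewrite /R; case: ltnP => hi; first by rewrite rmorphM /= map_polyXn hornerM hornerXn pz.
  rewrite (@horner_coef_wide _ i.+1); last by apply: leq_trans (size_poly _ _) (size_poly _ _).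
  rewrite -qz (@horner_coef_wide _ i.+1); last by rewrite (leq_trans (size_poly _ _)) ?leqW.
  rewrite mulr_sumr (reindex_inj rev_ord_inj) /=; apply: eq_bigr => -[j /= hj] _.
  rewrite !coef_map coef_poly subSS ltnS leq_subr subKn //= exprVn mulrCA -expfB_cond.
    by [].
  by rewrite (negPf w0).
pose G : 'M[A]_N.+1 := \matrix_(j, i) (R i)`_j.
exists (char_poly G); first exact: char_poly_monic.
rewrite map_char_poly -eigenvalue_root_char; apply/eigenvalueP.
exists (\row_i w ^+ i); last first.
  by apply/eqP => /rowP /(_ ord0); rewrite !mxE expr0 => /eqP; rewrite oner_eq0.
apply/rowP => i; rewrite !mxE mulrC -Rz.
rewrite (horner_coef_wide _ (leq_trans (size_poly _ _) (sR i))).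
by apply: eq_bigr => j _; rewrite !mxE coef_map mulrC.
Qed.

(** Dividing a monic equation of degree n + 1 by z^n writes z as a polynomial in 1/z, which lies in
    the image of A. *)
Lemma integral_inv_range (a : A) (z : E) :
  z != 0 -> f a = z^-1 -> integralOver f z -> exists b, z = f b.
Proof.
move=> z0 fa [p mp /rootP]; have := mp; rewrite monicE /lead_coef.
have := monic_neq0 mp; rewrite -size_poly_gt0 horner_coef size_map_poly_id0; last first.
  by rewrite (monicP mp) rmorph1 oner_neq0.
case: (size p) => // n _ /eqP /= pn; rewrite big_ord_recr /= coef_map /= pn rmorph1 mul1r.
case: n {pn} => [|n].
  by rewrite big_ord0 add0r expr0 => /eqP; rewrite oner_eq0.
move/eqP; rewrite addrC addr_eq0 => /eqP h.
exists (- \sum_(i < n.+1) p`_i * a ^+ (n - i)).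
rewrite rmorphN rmorph_sum /=; apply: (mulIf (expf_neq0 n z0)).
rewrite -exprS h mulNr mulr_suml; congr (- _); apply: eq_bigr => -[i /= hi] _.
rewrite coef_map rmorphM rmorphXn fa -mulrA; congr (_ * _).
by rewrite -{2}(subnK (_ : i <= n)%N) // exprD mulrA -exprMn mulVf // expr1n mul1r.
Qed.

End Adjoin.

Lemma subring_maximal (B0 : set E) z : is_subring B0 -> ~ B0 z ->
  exists B : subring_set E, [/\ B0 `<=` carrier B, ~ carrier B z &
    forall C, is_subring C -> carrier B `<=` C -> ~ C z -> C `<=` carrier B].
Proof.
move=> rB0 B0z.
pose good (B : set E) := [/\ is_subring B, B0 `<=` B & ~ B z].
pose G := [set B | B = set0 \/ good B].
have [F FG Ft|B [GB Bmax]] := @Zorn_bigcup E G.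
  have [[C FC gC]|hF] := pselect (exists2 C, F C & good C); last first.
    left; apply/seteqP; split=> // y [C FC Cy].
    case: (FG C FC) => [E0|gC]; last by case: hF; exists C.
    by move: Cy; rewrite E0.
  have gF D y : F D -> D y -> good D.
    by move=> FD Dy; case: (FG D FD) => // E0; move: Dy; rewrite E0.
  have two a b : (\bigcup_(X in F) X) a -> (\bigcup_(X in F) X) b ->
      exists D, [/\ F D, good D, D a & D b].
    move=> [D FD Da] [D' FD' D'b]; case: (Ft D D' FD FD') => s.
      by exists D'; split=> //; [apply: (gF D' b) | apply: s].
    by exists D; split=> //; [apply: (gF D a) | apply: s].
  right; split.
  - split.
    + by exists C => //; case: gC => -[].
    + move=> a b ha hb; have [D [FD gD Da Db]] := two a b ha hb.
      by exists D => //; case: gD => -[_ h _] _ _; apply: h.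
    + move=> a b ha hb; have [D [FD gD Da Db]] := two a b ha hb.
      by exists D => //; case: gD => -[_ _ h] _ _; apply: h.
  - by move=> y hy; exists C => //; case: gC => _ h _; apply: h.
  - by move=> [D FD Dz]; case: (gF D z FD Dz).
have gB : good B.
  case: GB => // E0; case: (Bmax B0); last by right; split.
  by rewrite E0 properEneq; split=> //; apply/eqP => E1; case: rB0; rewrite -E1.
case: gB => rB sB Bz; exists (SubringSet rB); split=> //= C rC sC Cz.
have [->//|nBC] := pselect (C = B).
exfalso; apply: (Bmax C); last by right; split=> //; apply: subset_trans sC.
by rewrite properEneq; split=> //; apply/eqP => h; apply: nBC.
Qed.

(** As z is not integral, it is not in A[1/z]; let B be maximal among the subrings that contain
    A[1/z] and avoid z. If neither w nor 1/w were in B, then z would be in both B[w] and B[1/w],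
    hence integral over B, hence in B because 1/z is. So B is a valuation ring. *)
Lemma place_avoiding (K : fieldType) (iota : {rmorphism K -> E})
    (A : comNzRingType) (f : {rmorphism A -> E}) z :
  (forall c, exists a, f a = iota c) -> ~ integralOver f z ->
  exists P : place iota, (forall a, vring P (f a)) /\ ~ vring P z.
Proof.
move=> fK fz; have z0 : z != 0 by apply: contra_not_neq fz => ->; exact: integral0.
have zV : ~ adjoin f z^-1 z.
  by move=> h; apply: fz; apply: (integral_adjoin_inv z0) => //; exact: adjoin_gen.
have [B [sB Bz Bmax]] := subring_maximal (adjoin_subring f z^-1) zV.
have BA a : carrier B (f a) by apply/sB/adjoin_base.
pose g := subring_incl B.
have gz w : w != 0 -> carrier B w \/ carrier B w^-1.
  move=> w0; apply: contrapT => /not_orP [Bw BwV].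
  have hmax y : ~ carrier B y -> adjoin g y z.
    move=> By; apply: contrapT => h; apply: By; apply: (Bmax (adjoin g y)) => //.
    - exact: adjoin_subring.
    - by move=> b /subring_incl_surj [b' <-]; exact: adjoin_base.
    - exact: adjoin_gen.
  have iz : integralOver g z by apply: (integral_adjoin_inv w0); apply: hmax.
  have [a ga] : exists a, g a = z^-1 by apply/subring_incl_surj/sB/adjoin_gen.
  by have [b zb] := integral_inv_range z0 ga iz; apply: Bz; rewrite zb; exact: subring_inclP.
have vB : is_valuation_ring iota (carrier B).
  have [B1 BB BM] := carrierP B.
  have Bt y : carrier B y \/ carrier B y^-1.
    by have [->|/gz//] := eqVneq y 0; left; rewrite -(subrr 1); apply: BB.
  split=> //.
    rewrite properEneq; split; last by move=> _ [c _ <-]; have [a <-] := fK c.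
    apply/eqP => h; case: (Bt z) => // ; rewrite -h => -[c _ ic]; apply: Bz.
    by have [a fa] := fK c^-1; rewrite -[z]invrK -ic -fmorphV -fa.
  by rewrite properEneq; split=> //; apply/eqP => h; apply: Bz; rewrite h.
by exists (Place vB).
Qed.

End Chevalley.

(** * Degrees and Riemann-Roch spaces *)

Section QuotientDimension.
Variables (K E : fieldType) (iota : {rmorphism K -> E}) (V W : set E).
Hypotheses (W0 : W 0) (WD : forall a b, W a -> W b -> W (a + b))
  (WZ : forall c a, W a -> W (iota c * a)).

(** This makes [quot_dim] independent of the basis. If m < n, the matrix expressing b' through b
    modulo W has a nonzero left kernel vector, which is a relation between the b' modulo W. *)
Lemma quot_basis_leq m n (b : 'I_m -> E) (b' : 'I_n -> E) :
  is_quot_basis iota V W b -> is_quot_basis iota V W b' -> (n <= m)%N.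
Proof.
move=> [_ _ gb] [Vb' fb' _]; rewrite leqNgt; apply/negP => ltmn.
have /choice [c hc] : forall j : 'I_n, exists c : 'I_m -> K,
    W (b' j - \sum_(i < m) iota (c i) * b i) by move=> j; exact: gb.
pose M : 'M[K]_(n, m) := \matrix_(j, i) c j i.
have kM : kermx M != 0.
  rewrite kermx_eq0 /row_free; apply: contraTN ltmn => /eqP h.
  by rewrite -leqNgt -{1}h rank_leq_col.
have [i vi0] : exists i, row i (kermx M) != 0.
  apply: contrapT => /forallNP h; case/eqP: kM; apply/row_matrixP => i; rewrite row0.
  by apply/eqP; rewrite -[_ == _]negbK; apply/negP/h.
set v := row i _ in vi0; have vM : v *m M = 0 by rewrite /v -row_mul mulmx_ker row0.
have Wv : W (\sum_(j < n) iota (v 0 j) * b' j).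
  have -> : \sum_(j < n) iota (v 0 j) * b' j =
      \sum_(j < n) iota (v 0 j) * (b' j - \sum_(i < m) iota (c j i) * b i).
    under [RHS]eq_bigr do rewrite mulrBr mulr_sumr.
    rewrite sumrB [X in _ - X]exchange_big /= [X in _ - X]big1 ?subr0 // => k _.
    under eq_bigr do rewrite mulrA -rmorphM.
    rewrite -mulr_suml -rmorph_sum (_ : \sum_j _ = (v *m M) 0 k).
      by rewrite vM mxE rmorph0 mul0r.
    by rewrite mxE; apply: eq_bigr => j _; rewrite [M _ _]mxE.
  by elim/big_ind: _ => // j _; apply/WZ/hc.
case/eqP: vi0; apply/rowP => j; rewrite [RHS]mxE.
exact: (fb' (fun j => v 0 j) Wv).
Qed.

Lemma quot_dim_basis n (b : 'I_n -> E) : is_quot_basis iota V W b -> quot_dim iota V W = n.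
Proof.
move=> hb; rewrite /quot_dim; case: xgetP => [m _ [b' hb']|/(_ n) []]; last by exists b.
by apply/eqP; rewrite eqn_leq (quot_basis_leq hb hb') (quot_basis_leq hb' hb).
Qed.

End QuotientDimension.

Section ResidueField.
Variables (K E : fieldType) (iota : {rmorphism K -> E}) (P : place iota).

Lemma place_degree_basis n (b : 'I_n -> E) :
  is_quot_basis iota (vring P) (videal P) b -> place_degree P = n.
Proof.
apply: quot_dim_basis; [exact: videal0 | exact: videalD | move=> c a].
by apply: videalMr; exact: vring_const.
Qed.

Lemma place_degree1 :
  (forall z, vring P z -> exists c, videal P (z - iota c)) -> place_degree P = 1%N.
Proof.
move=> h; apply: (@place_degree_basis _ (fun=> 1)); split=> [_|c|z hz].
- exact: vring1.
- by rewrite big_ord1 mulr1 => /videal_const h0 i; rewrite ord1.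
- by have [c hc] := h z hz; exists (fun=> c); rewrite big_ord1 mulr1.
Qed.

(** A positive value cannot be the default 0 of [quot_dim], so a basis exists, and freeness makes
    its first vector nonzero. *)
Lemma riemann_roch_space_nonzero (D : divisor iota) :
  (0 < div_ell D)%N -> exists2 z, riemann_roch_space D z & z != 0.
Proof.
rewrite /div_ell /quot_dim; case: xgetP => // n _ [b [bV bf _]] n0.
exists (b (Ordinal n0)); first exact: bV.
apply/eqP => b0; pose c i := if i == Ordinal n0 then 1 : K else 0.
have := bf c; rewrite (bigD1 (Ordinal n0)) //= b0 mulr0 add0r big1; last first.
  by move=> i /negPf ni; rewrite /c ni rmorph0 mul0r.
by move=> /(_ erefl (Ordinal n0)); rewrite /c eqxx => /eqP; rewrite oner_eq0.
Qed.

End ResidueField.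

Section DivisorDegree.
Variables (K E : fieldType) (iota : {rmorphism K -> E}).

Lemma div_degree_seq (D : divisor iota) (s : seq (place iota)) :
  uniq s -> (forall P, D P != 0 -> P \in s) ->
  div_degree D = \sum_(P <- s) D P * (place_degree P)%:Z.
Proof.
move=> us hs; rewrite /div_degree.
rewrite (fsbigE s) //; first by apply: eq_bigl => P; exact: mem_setT.
by move=> P _ hP; case: eqVneq (hs P) hP => [->|_ /(_ isT) ->]; rewrite ?mul0r.
Qed.

End DivisorDegree.

(** * Rational function fields *)

Section Evaluation.
Variables (K E : fieldType) (iota : {rmorphism K -> E}) (t : E).
Implicit Types (P Q : place iota) (f g h p : {poly K}) (z : E).

Definition eval_at f : E := (map_poly iota f).[t].
Local Notation ev := eval_at.

Fact eval_at_zmod : zmod_morphism ev.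
Proof. by move=> f g; rewrite /eval_at rmorphB !hornerE. Qed.

Fact eval_at_monoid : monoid_morphism ev.
Proof. by split=> [|f g]; rewrite /eval_at ?rmorph1 ?rmorphM !hornerE. Qed.

HB.instance Definition _ := GRing.isZmodMorphism.Build {poly K} E ev eval_at_zmod.
HB.instance Definition _ := GRing.isMonoidMorphism.Build {poly K} E ev eval_at_monoid.

Lemma eval_at0 : ev 0 = 0. Proof. exact: rmorph0. Qed.
Lemma eval_at1 : ev 1 = 1. Proof. exact: rmorph1. Qed.
Lemma eval_atD f g : ev (f + g) = ev f + ev g. Proof. exact: rmorphD. Qed.
Lemma eval_atB f g : ev (f - g) = ev f - ev g. Proof. exact: rmorphB. Qed.
Lemma eval_atM f g : ev (f * g) = ev f * ev g. Proof. exact: rmorphM. Qed.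
Lemma eval_atXn f n : ev (f ^+ n) = ev f ^+ n. Proof. exact: rmorphXn. Qed.

Lemma eval_atE f : ev f = (map_poly iota f).[t]. Proof. by []. Qed.

Lemma eval_atC c : ev c%:P = iota c.
Proof. by rewrite eval_atE map_polyC hornerC. Qed.

Lemma eval_atX : ev 'X = t. Proof. by rewrite eval_atE map_polyX hornerX. Qed.

Lemma vring_eval P f : vring P t -> vring P (ev f).
Proof.
move=> ht; rewrite eval_atE horner_coef; apply: vring_sum => i _.
by apply: vringM; [rewrite coef_map; exact: vring_const | exact: vringX].
Qed.

Lemma eval_at_pole P f : ~ vring P t -> f != 0 ->
  exists2 u, ev f = t ^+ (size f).-1 * u & videal P (u - iota (lead_coef f)).
Proof.
move=> ht f0; have t0 : t != 0 by apply: contra_not_neq ht => ->; exact: vring0.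
exists (ev f / t ^+ (size f).-1); first by rewrite mulrC divfK // expf_neq0.
have := @horner_pole _ _ _ P t (map_poly iota f) ht.
rewrite size_map_poly lead_coef_map; apply=> i.
by rewrite coef_map; exact: vring_const.
Qed.

Lemma residue_unit P u c : c != 0 -> videal P (u - iota c) -> vunits P u.
Proof.
by move=> c0 h; rewrite -[u](subrK (iota c)) addrC; apply: vunitsD => //; exact: vunits_const.
Qed.

(** Only the leading terms count at a pole of t: the exponent is the difference of the degrees, and
    c is the quotient of the leading coefficients. *)
Lemma eval_at_frac_pole P f g : ~ vring P t -> f != 0 -> g != 0 ->
  exists u c, [/\ ev f / ev g = t ^ ((size f)%:Z - (size g)%:Z) * u,
                  c != 0 & videal P (u - iota c)].
Proof.
move=> ht f0 g0; have t0 : t != 0 by apply: contra_not_neq ht => ->; exact: vring0.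
have [u -> hu] := eval_at_pole ht f0; have [v -> hv] := eval_at_pole ht g0.
have lf0 : lead_coef f != 0 by rewrite lead_coef_eq0.
have lg0 : lead_coef g != 0 by rewrite lead_coef_eq0.
have uv := residue_unit lg0 hv; have v0 := vunits_neq0 uv.
exists (u / v), (lead_coef f / lead_coef g); split.
- have [m Em] : exists m, size f = m.+1 by exists (size f).-1; rewrite prednK // size_poly_gt0.
  have [n En] : exists n, size g = n.+1 by exists (size g).-1; rewrite prednK // size_poly_gt0.
  rewrite Em En /= (_ : _ - _ = m%:Z - n%:Z :> int); last by lia.
  by rewrite expfzDr // -exprnN -exprnP; field; rewrite v0 expf_neq0.
- by rewrite mulf_neq0 // invr_eq0.
- rewrite fmorph_div; set a := iota (lead_coef f); set b := iota (lead_coef g).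
  have b0 : b != 0 by rewrite fmorph_eq0.
  rewrite (_ : u / v - a / b = ((u - a) * b - a * (v - b)) * (v^-1 * b^-1)); last first.
    by field; rewrite v0 b0.
  apply: videalM; last first.
    by apply: vringM; [exact/vunits_vring/vunitsV | rewrite -fmorphV; exact: vring_const].
  by apply: videalB; [apply: videalM | apply: videalMr] => //; exact: vring_const.
Qed.

(** The prime ideal that P cuts out on K[X] through t is generated by p. No normalisation is
    imposed, so p is determined up to a constant. *)
Definition place_poly P p : Prop :=
  [/\ p != 0, videal P (ev p) & forall f, videal P (ev f) -> p %| f].

Lemma place_poly_exists P f : vring P t -> f != 0 -> videal P (ev f) ->
  exists p, place_poly P p.
Proof.
move=> ht f0 hf.
pose ok n := `[< exists p, [/\ p != 0, videal P (ev p) & size p = n] >].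
have ex : exists n, ok n by exists (size f); apply/asboolP; exists f.
case: (ex_minnP ex) => n /asboolP [p [p0 hp sp]] nmin.
exists p; split=> // g hg; rewrite /dvdp; apply/negPn/negP => r0.
have := ltn_modp g p; rewrite p0 ltnNge => /negP; apply.
rewrite sp; apply: nmin; apply/asboolP; exists (g %% p); split=> //.
have -> : g %% p = g - g %/ p * p by rewrite {2}(divp_eq g p) addrC addKr.
rewrite eval_atB eval_atM; apply: videalB => //.
by apply: videalMr => //; exact: vring_eval.
Qed.

Lemma place_poly_dvd P p f : vring P t -> place_poly P p -> (videal P (ev f) <-> p %| f).
Proof.
move=> ht [p0 hp h]; split=> [/h//|/dvdpP [q ->]].
by rewrite eval_atM; apply: videalMr => //; exact: vring_eval.
Qed.

Lemma place_poly_unit P p f : vring P t -> place_poly P p -> (vunits P (ev f) <-> ~~ (p %| f)).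
Proof.
move=> ht hp; split=> [/vunitsP [_ h]|/negP h].
  by apply/negP => /(place_poly_dvd _ ht hp).
by apply/vunitsP; split; [exact: vring_eval | move=> /(place_poly_dvd _ ht hp)].
Qed.

Lemma place_poly_size P p : place_poly P p -> (1 < size p)%N.
Proof.
move=> [p0 hp _]; rewrite ltnNge; apply/negP => /size1_polyC e; move: hp p0.
by rewrite e eval_atC => /videal_const ->; rewrite polyC0 eqxx.
Qed.

Lemma place_poly_irreducible P p : vring P t -> place_poly P p -> irreducible_poly p.
Proof.
move=> ht hp; have [p0 hp1 h] := hp; split; first exact: place_poly_size hp.
move=> q sq /dvdpP [e pe].
have /andP [e0 q0] : (e != 0) && (q != 0) by rewrite -negb_or -mulf_eq0 -pe.
have nep : ~~ (p %| e).
  apply/negP => /(dvdp_leq e0); rewrite pe size_mul // => le.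
  move: sq le; rewrite -size_poly_gt0 in e0; rewrite -size_poly_gt0 in q0.
  by move: (size e) (size q) e0 q0 => i j; lia.
have ue : vunits P (ev e) by apply/(place_poly_unit _ ht hp).
rewrite /eqp; apply/andP; split; first by apply/dvdpP; exists e.
apply: h; rewrite (_ : ev q = ev p * (ev e)^-1); last first.
  by rewrite pe eval_atM mulrAC divff ?mul1r // (vunits_neq0 ue).
by apply: videalM => //; exact/vunits_vring/vunitsV.
Qed.

Lemma eval_at_place_poly P p f : vring P t -> place_poly P p -> f != 0 ->
  exists (n : nat) u, vunits P u /\ ev f = ev p ^+ n * u.
Proof.
move=> ht hp; have p1 := place_poly_size hp.
have [n] := ubnP (size f); elim: n f => // n IH f /ltnSE sf f0.
have [/dvdpP [q fq]|nd] := boolP (p %| f); last first.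
  by exists 0%N, (ev f); rewrite expr0 mul1r; split=> //; apply/(place_poly_unit _ ht hp).
have q0 : q != 0 by apply: contra_neq f0 => q0; rewrite fq q0 mul0r.
have p0 : p != 0 by case: hp.
have [|m [u [hu E1]]] := IH q _ q0.
  by apply: leq_trans sf; rewrite fq size_mul //; move: p1; move: (size q) (size p) => i j; lia.
by exists m.+1, u; split=> //; rewrite fq eval_atM E1 exprSr; ring.
Qed.

Lemma place_poly_residue P p f g : vring P t -> place_poly P p -> ~~ (p %| g) ->
  exists h, (size h < size p)%N /\ videal P (ev f / ev g - ev h).
Proof.
move=> ht hp ng; have [p0 hp1 _] := hp.
have : coprimep p g by rewrite (irreducible_poly_coprime _ (place_poly_irreducible ht hp)).
move=> /Bezout_eq1_coprimepP [[u v] /= uv].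
(* By Bezout u p + v g = 1, so v inverts g modulo p. *)
exists ((f * v) %% p); split; first by rewrite ltn_modp.
have ug : vunits P (ev g) by apply/(place_poly_unit _ ht hp).
have g0 := vunits_neq0 ug.
have -> : (f * v) %% p = f * v - (f * v) %/ p * p.
  by rewrite {2}(divp_eq (f * v) p) addrC addKr.
have uv' : ev u * ev p = 1 - ev v * ev g.
  by rewrite -!eval_atM -(eval_at1) -eval_atB -uv addrK.
rewrite eval_atB !eval_atM (_ : _ - _ = ev p * (ev f * ev u / ev g + ev ((f * v) %/ p))).
  apply: videalM => //; apply: vringD; last exact: vring_eval.
  by do ![apply: vringM; try exact: vring_eval]; exact/vunits_vring/vunitsV.
transitivity (ev f * (1 - ev v * ev g) / ev g + ev ((f * v) %/ p) * ev p); first by field.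
by rewrite -uv'; field.
Qed.
End Evaluation.

(** * Places of the rational function field K(t), with t transcendental *)

Section RationalFunctionField.
Variables (K E : fieldType) (iota : {rmorphism K -> E}) (t : E).
Implicit Types (P Q : place iota) (f g h p : {poly K}) (z : E).
Local Notation ev := (eval_at iota t).
Hypotheses (t_transc : forall f, f != 0 -> ev f != 0)
  (t_gen : forall z, exists f g, g != 0 /\ z = ev f / ev g).

Lemma eval_at_inj : injective ev.
Proof.
move=> f g fg; apply/eqP; rewrite -subr_eq0; apply: contraTT isT => /t_transc.
by rewrite eval_atB fg subrr eqxx.
Qed.

Lemma coprime_frac z : exists f g, [/\ g != 0, coprimep f g & z = ev f / ev g].
Proof.
have [f [g [g0 ->]]] := t_gen z; set d := gcdp f g.
have d0 : d != 0 by rewrite gcdp_eq0 negb_and g0 orbT.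
have fE : f = f %/ d * d by rewrite divpK // dvdp_gcdl.
have gE : g = g %/ d * d by rewrite divpK // dvdp_gcdr.
exists (f %/ d), (g %/ d); split.
- by apply: contra_neq g0 => e; rewrite gE e mul0r.
- by apply: coprimep_div_gcd; rewrite g0 orbT.
- by rewrite {1}fE {1}gE !eval_atM -mulf_div divff ?mulr1 // t_transc.
Qed.

(** A transcendental t is not integral over K, so some valuation ring avoids it. *)
Lemma infinite_place_exists : exists P, ~ vring P t.
Proof.
have [|P [_ hP]] := @place_avoiding E K iota K iota t (fun c => ex_intro _ c erefl);
  last by exists P.
move=> [p mp /rootP pt]; have := t_transc (monic_neq0 mp).
by rewrite eval_atE pt eqxx.
Qed.

Lemma frac_neq0 z f g : z != 0 -> z = ev f / ev g -> f != 0.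
Proof. by move=> z0 zE; apply: contra_neq z0 => f0; rewrite zE f0 eval_at0 mul0r. Qed.

Lemma infinite_uniformizer P : ~ vring P t -> uniformizer P t^-1.
Proof.
move=> ht; split; first exact: videalV.
move=> z z0; have [f [g [g0 zE]]] := t_gen z.
have [u [c [E1 c0 hu]]] := eval_at_frac_pole ht (frac_neq0 z0 zE) g0.
exists ((size g)%:Z - (size f)%:Z), u; split; first exact: residue_unit hu.
by rewrite zE E1 exprz_inv opprB.
Qed.

Lemma infinite_vring P f g : ~ vring P t -> g != 0 ->
  vring P (ev f / ev g) <-> (size f <= size g)%N.
Proof.
move=> ht g0; have [->|f0] := eqVneq f 0.
  by rewrite eval_at0 mul0r size_poly0; split=> // _; exact: vring0.
have ut := infinite_uniformizer ht; have dP : discrete_place P by exists t^-1.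
have [u [c [E1 c0 hu]]] := eval_at_frac_pole ht f0 g0.
have z0 : ev f / ev g != 0 by rewrite mulf_neq0 ?invr_eq0 ?t_transc.
rewrite (val_at_ge0 dP z0) E1 -[t in t ^ _]invrK exprz_inv.
rewrite (val_at_uniformizer _ ut (residue_unit c0 hu)); split; lia.
Qed.

Lemma infinite_place_unique P Q : ~ vring P t -> ~ vring Q t -> P = Q.
Proof.
move=> hP hQ; apply/place_inj/seteqP; split=> z;
  have [f [g [g0 ->]]] := t_gen z; rewrite !infinite_vring //.
Qed.

Lemma infinite_val P f : ~ vring P t -> f != 0 -> val_at P (ev f) = - ((size f).-1)%:Z.
Proof.
move=> ht f0; have ut := infinite_uniformizer ht.
have [u -> hu] := eval_at_pole ht f0.
rewrite exprnP -[t in t ^ _]invrK exprz_inv (val_at_uniformizer _ ut) //.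
by apply: residue_unit hu; rewrite lead_coef_eq0.
Qed.

Lemma infinite_place_degree P : ~ vring P t -> place_degree P = 1%N.
Proof.
move=> ht; apply: place_degree1 => z hz.
have [->|z0] := eqVneq z 0; first by exists 0; rewrite rmorph0 subrr; exact: videal0.
have [f [g [g0 zE]]] := t_gen z; have f0 := frac_neq0 z0 zE.
have := hz; rewrite zE infinite_vring // leq_eqVlt => /orP [/eqP sfg|lt].
  have [u [c [E1 c0 hu]]] := eval_at_frac_pole ht f0 g0.
  by exists c; rewrite E1 sfg subrr expr0z mul1r.
exists 0; rewrite rmorph0 subr0 -zE; apply/videalP; right.
by rewrite zE invf_div infinite_vring //; apply/negP; rewrite -ltnNge.
Qed.

Lemma place_poly_ex P : vring P t -> exists p, place_poly t P p.
Proof.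
move=> ht; have [z hz] := vring_proper P; have [f [g [g0 zE]]] := t_gen z.
apply: (place_poly_exists ht g0); apply: contrapT => h; apply: hz; rewrite zE.
apply: vringM; first exact: vring_eval.
by apply/vunits_vring/vunitsV/vunitsP; split=> //; exact: vring_eval.
Qed.

Lemma finite_uniformizer P p : vring P t -> place_poly t P p -> uniformizer P (ev p).
Proof.
move=> ht hp; have [p0 hp1 _] := hp; split=> // z z0; have [f [g [g0 zE]]] := t_gen z.
have [m [u [hu E1]]] := eval_at_place_poly ht hp (frac_neq0 z0 zE).
have [n [v [hv E2]]] := eval_at_place_poly ht hp g0.
exists (m%:Z - n%:Z), (u / v); split; first by apply/vunitsM/vunitsV.
have pn0 := t_transc p0.
rewrite zE E1 E2 expfzDr // -exprnN -exprnP.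
by field; rewrite (vunits_neq0 hv) expf_neq0.
Qed.

Lemma finite_vring P p f g : vring P t -> place_poly t P p -> g != 0 -> coprimep f g ->
  vring P (ev f / ev g) <-> ~~ (p %| g).
Proof.
move=> ht hp g0 cfg; split=> [hz|pg]; last first.
  apply: vringM; first exact: vring_eval.
  by apply/vunits_vring/vunitsV/(place_poly_unit _ ht hp).
apply/negP => pg; have hg : videal P (ev g) by apply/(place_poly_dvd _ ht hp).
have : videal P (ev f) by rewrite -[ev f](divfK (t_transc g0)); exact: videalMr.
move=> /(place_poly_dvd _ ht hp) pf.
have := place_poly_size hp; rewrite ltnNge => /negP; apply.
have /dvdp_leq : p %| gcdp f g by rewrite dvdp_gcd pf.
by rewrite gcdp_eq0 negb_and g0 orbT (eqP cfg); apply.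
Qed.

Lemma finite_place_inj P Q p : vring P t -> vring Q t -> place_poly t P p ->
  place_poly t Q p -> P = Q.
Proof.
move=> hP hQ pP pQ; apply/place_inj/seteqP; split=> z;
  have [f [g [g0 cfg ->]]] := coprime_frac z;
  by rewrite (finite_vring hP pP) // (finite_vring hQ pQ).
Qed.

Lemma sum_eval n (c : 'I_n -> K) :
  \sum_(i < n) iota (c i) * t ^+ i = ev (rVpoly (\row_i c i)).
Proof.
rewrite eval_atE (@horner_coef_wide _ n); last exact: leq_trans (size_poly _ _) (size_poly _ _).
by apply: eq_bigr => i _; rewrite coef_map coef_rVpoly_ord mxE.
Qed.

(** The residue field is K[X]/(p), with the powers of t below deg p as a basis. *)
Lemma finite_place_degree P p : vring P t -> place_poly t P p ->
  place_degree P = (size p).-1.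
Proof.
move=> ht hp; have p1 := place_poly_size hp.
apply: (@place_degree_basis _ _ _ _ _ (fun i => t ^+ i)); split.
- by move=> i; exact: vringX.
- move=> c; rewrite sum_eval => /(place_poly_dvd _ ht hp) pd i.
  have [r0|r0] := eqVneq (rVpoly (\row_i c i)) 0.
    by have := coef_rVpoly_ord (\row_i c i) i; rewrite r0 coef0 mxE.
  have := leq_trans (dvdp_leq r0 pd) (size_poly _ _); move: p1; move: (size p) => n; lia.
- move=> z; have [f [g [g0 cfg ->]]] := coprime_frac z.
  move=> /(finite_vring ht hp g0 cfg) /(place_poly_residue f ht hp) [h [sh hz]].
  exists (fun i => h`_i); rewrite sum_eval.
  have -> : \row_(i < (size p).-1) h`_i = poly_rV h by apply/rowP => i; rewrite !mxE.
  rewrite poly_rV_K //.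
  by move: sh; move: (size h) (size p) => m n; lia.
Qed.

(** For z = f/g in lowest terms with u f + v g = 1, the element 1/g = u z + v has no finite pole
    either. It is therefore integral over K[t], and since its inverse g is in K[t], so is 1/g
    itself. *)
Lemma eval_of_vring_finite z : (forall P, vring P t -> vring P z) -> exists h, z = ev h.
Proof.
have [f [g [g0 cfg zE]]] := coprime_frac z => hz.
have eg0 := t_transc g0.
have [[u v] /= uv] := Bezout_eq1_coprimepP _ _ cfg.
have gV : (ev g)^-1 = ev u * z + ev v.
  rewrite zE; apply: (mulIf eg0); rewrite mulVf // mulrDl -mulrA divfK //.
  by rewrite -!eval_atM -eval_atD uv eval_at1.
have iV : integralOver ev (ev g)^-1.
  apply: contrapT => nint.
  have [|P [hP]] := @place_avoiding E K iota _ ev (ev g)^-1 _ nint.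
    by move=> c; exists c%:P; exact: eval_atC.
  apply; rewrite gV; apply: vringD; last exact: hP.
  by apply: vringM; [exact: hP | apply: hz; rewrite -(eval_atX iota t); exact: hP].
have [|b gb] := @integral_inv_range _ _ ev g (ev g)^-1 _ (esym (invrK _)) iV.
  by rewrite invr_eq0.
by exists (f * b); rewrite zE gb eval_atM.
Qed.

(** * Riemann-Roch spaces of K(t) *)

Section RiemannRoch.
Variable D : divisor iota.

Let supp : exists s : seq (place iota),
  [/\ uniq s, forall P, D P != 0 -> P \in s & exists2 P, P \in s & ~ vring P t].
Proof.
have [P hP] := infinite_place_exists.
have /finite_seqP [s sE] := div_finite D.
exists (undup (P :: s)); split; first exact: undup_uniq.
  move=> Q hQ; rewrite mem_undup inE; apply/orP; right.
  by have : [set P | div_coef D P != 0] Q by []; rewrite sE.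
by exists P => //; rewrite mem_undup mem_head.
Qed.

(** Up to a multiple of the infinite place every divisor of K(t) is principal: F is the product of
    the [pp P ^ D P] over finite P. Its order at infinity is forced, since [pp P] has there a pole
    of order equal to the degree of P. *)
Lemma divisor_generator : exists2 F, F != 0 &
  (forall P, vring P t -> val_at P F = D P) /\
  (forall P, ~ vring P t -> val_at P F = D P - div_degree D).
Proof.
have [s [us hs [P0 P0s hP0]]] := supp.
have /choice [pp hpp] : forall P, exists p, vring P t -> place_poly t P p.
  move=> P; have [ht|nt] := pselect (vring P t); last by exists 0.
  by have [p hp] := place_poly_ex ht; exists p.
pose fin P := `[< vring P t >].
have ev0 P : fin P -> ev (pp P) != 0.
  by move=> /asboolP /hpp [p0 _ _]; exact: t_transc.
have Fi P : fin P -> ev (pp P) ^ D P != 0 by move=> /ev0; exact: expfz_neq0.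
have dfin P : vring P t -> discrete_place P.
  by move=> ht; exists (ev (pp P)); apply: finite_uniformizer => //; exact: hpp.
exists (\prod_(P <- s | fin P) ev (pp P) ^ D P).
  by elim/big_ind: _ => // [|x y x0 y0]; [exact: oner_neq0 | exact: mulf_neq0].
split=> Q hQ.
  have dQ := dfin Q hQ; rewrite val_at_prod //.
  have vE P : fin P -> val_at Q (ev (pp P) ^ D P) = (P == Q)%:Z * D P.
    move=> fP; have hP := asboolW fP; rewrite val_at_expz ?ev0 //; congr (_ * _).
    have [->|nPQ] := eqVneq P Q.
      have := val_at_uniformizer 1 (finite_uniformizer hQ (hpp Q hQ)) (vunits1 Q).
      by rewrite expr1z mulr1.
    (* At a finite place Q other than P the polynomial of P is a unit: otherwise the polynomial of Q
       divides it, the two are associate by irreducibility, and P = Q. *)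
    rewrite (val_at_unit dQ) //; apply/(place_poly_unit _ hQ (hpp Q hQ)); apply/negP => dv.
    case/eqP: nPQ; apply: (finite_place_inj hP hQ (hpp P hP)).
    have [_ irr] := place_poly_irreducible hP (hpp P hP).
    have eqp : pp Q %= pp P.
      by apply: irr => //; rewrite neq_ltn (place_poly_size (hpp Q hQ)) orbT.
    have [p0 _ _] := hpp P hP; split=> //.
      by apply/(place_poly_dvd _ hQ (hpp Q hQ)).
    by move=> f /(place_poly_dvd _ hQ (hpp Q hQ)); rewrite (eqp_dvdl _ eqp).
  rewrite (eq_bigr _ vE) big_mkcond /=.
  have [Qs|nQs] := boolP (Q \in s).
    rewrite (bigD1_seq Q) //= big1 => [|P /negPf nP]; last by rewrite nP mul0r if_same.
    by rewrite eqxx mul1r addr0 (_ : fin Q) //; exact/asboolP.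
  rewrite big_seq big1 => [|P Ps].
    by apply/esym/eqP; rewrite -[_ == _]negbK; apply/negP => /hs; exact/negP.
  case: ifP => // _; case: eqVneq => [PQ|]; last by rewrite mul0r.
  by rewrite -PQ Ps in nQs.
have QP0 : Q = P0 := infinite_place_unique hQ hP0.
have dQ : discrete_place Q by exists t^-1; exact: infinite_uniformizer.
rewrite (div_degree_seq us hs) val_at_prod // (bigD1_seq P0) //= -QP0.
rewrite (infinite_place_degree hQ) mulr1 opprD addrA subrr add0r.
rewrite big_mkcond [X in - X]big_mkcond /= -sumrN; apply: eq_bigr => P _.
have [ht|nt] := pselect (vring P t); last first.
  have -> : fin P = false by apply/negP => /asboolP.
  by rewrite QP0 (infinite_place_unique nt hP0) eqxx oppr0.
have -> : fin P by apply/asboolP.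
have -> : P != Q by apply/eqP => PQ; apply: hQ; rewrite -PQ.
rewrite val_at_expz ?ev0 //; last by apply/asboolP.
have [p0 _ _] := hpp P ht.
by rewrite infinite_val // (finite_place_degree ht (hpp P ht)) mulNr mulrC.
Qed.

(** Multiplication by F identifies the space of D with the polynomials in t of degree at most m: at
    finite places z F must be regular, and at infinity its pole order is bounded by the degree of
    D. *)
Lemma div_ell_rational (m : nat) : div_degree D = m%:Z -> div_ell D = m.+1.
Proof.
move=> dD; have [F F0 [Ffin Finf]] := divisor_generator.
have dfin P : vring P t -> discrete_place P.
  by move=> ht; have [p hp] := place_poly_ex ht; exists (ev p); exact: finite_uniformizer.
have dinf P : ~ vring P t -> discrete_place P.
  by move=> ht; exists t^-1; exact: infinite_uniformizer.
have LP z : riemann_roch_space D z <-> exists h, (size h <= m.+1)%N /\ z = ev h / F.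
  have [->|z0] := eqVneq z 0.
    split=> _; last by rewrite /riemann_roch_space /= eqxx.
    by exists 0; rewrite size_poly0 eval_at0 mul0r.
  have zF0 : z * F != 0 by rewrite mulf_neq0.
  split=> [/(_ z0) hz|[h [sh zE]] _ P].
    have [|h hE] := @eval_of_vring_finite (z * F).
      move=> P ht; apply/(val_at_ge0 (dfin P ht)) => //.
      by rewrite val_atM ?Ffin //; [have := hz P; lia | exact: dfin].
    exists h; split; last by rewrite -hE mulfK.
    have h0 : h != 0 by apply: contra_neq zF0 => h0; rewrite hE h0 eval_at0.
    have [P hP] := infinite_place_exists.
    have := val_atM (dinf P hP) z0 F0; rewrite hE infinite_val // Finf // dD.
    by have := hz P; rewrite -size_poly_gt0 in h0; move: (size h) h0; lia.
  have hE : ev h = z * F by rewrite zE divfK.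
  have h0 : h != 0 by apply: contra_neq zF0 => h0; rewrite -hE h0 eval_at0.
  have [ht|nt] := pselect (vring P t).
    have := val_atM (dfin P ht) z0 F0; rewrite Ffin // -hE.
    have /(val_at_ge0 (dfin P ht) (t_transc h0)) := vring_eval h ht; lia.
  have := val_atM (dinf P nt) z0 F0; rewrite -hE infinite_val // Finf // dD.
  by rewrite -size_poly_gt0 in h0; move: (size h) h0 sh; lia.
apply: (@quot_dim_basis _ _ _ _ [set 0] _ _ _ _ (fun i : 'I_m.+1 => t ^+ i / F)) => /=.
- by [].
- by move=> a b -> ->; rewrite addr0.
- by move=> c a ->; rewrite mulr0.
have sE (c : 'I_m.+1 -> K) :
    \sum_(i < m.+1) iota (c i) * (t ^+ i / F) = ev (rVpoly (\row_i c i)) / F.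
  by rewrite -sum_eval mulr_suml; apply: eq_bigr => i _; rewrite mulrA.
split.
- move=> i; apply/LP; exists 'X^i; rewrite size_polyXn ltn_ord; split=> //.
  by rewrite eval_atXn eval_atX.
- move=> c; rewrite sE => /eqP; rewrite mulf_eq0 invr_eq0 (negPf F0) orbF => /eqP h i.
  have r0 : rVpoly (\row_i c i) = 0 by apply: eval_at_inj; rewrite h eval_at0.
  by have := coef_rVpoly_ord (\row_i c i) i; rewrite r0 coef0 mxE.
- move=> z /LP [h [sh zE]]; exists (fun i => h`_i); rewrite sE.
  have -> : \row_(i < m.+1) h`_i = poly_rV h by apply/rowP => i; rewrite !mxE.
  by rewrite poly_rV_K // zE subrr.
Qed.

End RiemannRoch.

Lemma rational_genus0 : has_genus iota 0.
Proof.
split; last first.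
  (* In degree at most -1 the bound holds simply because [div_ell D] is a natural number. *)
  move=> D; case dD : (div_degree D) => [m|m]; last by lia.
  by rewrite (div_ell_rational dD); lia.
have fin0 : finite_set [set P : place iota | (0 : int) != 0].
  by rewrite (_ : [set _ | _] = set0) //; apply/seteqP; split=> P //=; rewrite eqxx.
pose D := Divisor fin0; have dD : div_degree D = 0.
  by rewrite (@div_degree_seq _ _ _ D [::]) ?big_nil // => P /=; rewrite eqxx.
by exists D; rewrite dD (div_ell_rational dD).
Qed.

End RationalFunctionField.

(** * Places of a quadratic extension *)

Section Dominance.
Variables (K E : fieldType) (iota : {rmorphism K -> E}).

(** The ultrametric principle without a value group: when three terms sum to 0, two of them have the
    same largest value, so that their quotient is a unit. *)
Lemma three_terms (R : place iota) (a b c : E) :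
  a + b + c = 0 -> [|| a != 0, b != 0 | c != 0] ->
  [\/ [/\ a != 0, b != 0 & vunits R (a / b)], [/\ c != 0, b != 0 & vunits R (c / b)]
    | [/\ c != 0, a != 0 & vunits R (c / a)]].
Proof.
have uN1 : vunits R (-1).
  by split; rewrite ?oppr_eq0 ?oner_eq0 // invrN invr1; split; apply/vringN/vring1.
move/eqP; rewrite addr_eq0 => /eqP abc; have cab : c = - (a + b) by rewrite abc opprK.
have [a0|a0] := eqVneq a 0.
  have [b0|b0 _] := eqVneq b 0; first by rewrite cab a0 b0 addr0 oppr0 eqxx.
  by apply: Or32; split=> //; rewrite cab a0 add0r ?oppr_eq0 // mulNr divff.
have [b0 _|b0 _] := eqVneq b 0.
  by apply: Or33; split=> //; rewrite cab b0 addr0 ?oppr_eq0 // mulNr divff.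
have c0 d w : d != 0 -> vunits R w -> c = - (d * w) -> c != 0 /\ vunits R (c / d).
  move=> d0 uw ->; have w0 := vunits_neq0 uw; split; first by rewrite oppr_eq0 mulf_neq0.
  by rewrite mulNr mulrAC divff // mul1r -mulN1r; exact: vunitsM.
have [ab|nab] := pselect (vring R (a / b)); last first.
  have [||h1 h2] := c0 a (1 + (a / b)^-1) a0; last by apply: Or33.
    by apply: vunitsD; [exact: vunits1 | exact: videalV].
  by rewrite cab; field; rewrite a0 b0.
have [ba|nba] := pselect (vring R (a / b)^-1).
  by apply: Or31; split=> //; split=> //; rewrite mulf_neq0 // invr_eq0.
have [||h1 h2] := c0 b (1 + a / b) b0; last by apply: Or32.
  by apply: vunitsD; [exact: vunits1 | rewrite -[a / b]invrK; exact: videalV].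
by rewrite cab; field.
Qed.

End Dominance.

Lemma dim2_relation (L : fieldType) (V : vectType L) (z1 z2 z3 : V) :
  \dim {: V} = 2%N -> exists a1 a2 a3,
  [|| a1 != 0, a2 != 0 | a3 != 0] /\ a1 *: z1 + a2 *: z2 + a3 *: z3 = 0.
Proof.
move=> dV; have : ~~ free [tuple z1; z2; z3].
  by rewrite /free neq_ltn (leq_ltn_trans (dimvS (subvf _))) // dV.
apply: contraNP => h; apply/freeP => k k0 i.
have e : k ord0 *: z1 + k (lift ord0 ord0) *: z2 + k (lift ord0 (lift ord0 ord0)) *: z3 = 0.
  by rewrite -[RHS]k0 !big_ord_recl big_ord0 addr0 addrA.
apply/eqP; rewrite -[_ == _]negbK; apply/negP => ki; apply: h.
exists (k ord0), (k (lift ord0 ord0)), (k (lift ord0 (lift ord0 ord0))); split=> //.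
have : [|| i == ord0, i == lift ord0 ord0 | i == lift ord0 (lift ord0 ord0)].
  by case: i {ki} => [[|[|[|]]]].
by case/or3P => /eqP <-; rewrite ki ?orbT.
Qed.

Section QuadraticExtension.
Variables (K L : fieldType) (F : fieldExtType L) (iota : {rmorphism K -> F}) (x : F).
Local Notation ev := (eval_at iota x).
Implicit Types (P Q R : place iota) (z : F) (a b : L).

Definition base a : F := a%:A.

Fact base_zmod : zmod_morphism base.
Proof. by move=> a b; rewrite /base scalerBl. Qed.

Fact base_monoid : monoid_morphism base.
Proof. by split=> [|a b]; rewrite /base ?scale1r // -scalerAl mul1r scalerA. Qed.

HB.instance Definition _ := GRing.isZmodMorphism.Build _ F base base_zmod.
HB.instance Definition _ := GRing.isMonoidMorphism.Build _ F base base_monoid.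

Hypotheses (F_quadratic : (\dim {: F} = 2)%N)
  (x_transc : forall f, f != 0 -> ev f != 0)
  (base_frac : forall a, exists f g, g != 0 /\ base a = ev f / ev g).

Lemma linear_relation z1 z2 z3 : exists a1 a2 a3,
  [|| a1 != 0, a2 != 0 | a3 != 0] /\ base a1 * z1 + base a2 * z2 + base a3 * z3 = 0.
Proof.
have [a1 [a2 [a3 [h E1]]]] := dim2_relation z1 z2 z3 F_quadratic.
by exists a1, a2, a3; split=> //; rewrite /base !mulr_algl.
Qed.


(** * Elements of K(x) at the infinite places of F *)

Definition infinite P : Prop := ~ vring P x.

(** The sign of n decides although the place may still be ramified, with x^-1 no uniformizer. *)
Lemma infinite_expz P u (n : int) : infinite P -> vunits P u ->
  (vring P (x ^ n * u) <-> n <= 0) /\ (videal P (x ^ n * u) <-> n < 0).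
Proof.
move=> hP hu; have xV := videalV hP.
have low m : videal P (x ^ (Negz m) * u).
  by rewrite NegzE -exprnN -exprVn; apply: videalM; [exact: videalXn | exact: vunits_vring].
have zero : vunits P (x ^ 0 * u) by rewrite expr0z mul1r.
have high m : ~ vring P (x ^ m.+1 * u).
  have u0 := vunits_neq0 hu; have x0 : x != 0 by apply: contra_not_neq hP => ->; exact: vring0.
  move=> h; apply: (@videal1 _ _ _ P).
  rewrite (_ : 1 = (x ^ m.+1 * u) * (x^-1 ^+ m.+1 * u^-1)).
    apply: videalMr => //; apply: videalM; first exact: videalXn.
    exact/vunits_vring/vunitsV.
  by rewrite -exprnP exprVn; field; rewrite u0 expf_neq0.
case: n => [[|n]|n]; split; split=> //.
- by move=> _; exact: vunits_vring.
- by case/vunitsP: zero.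
- by move/high.
- by move/videal_vring/high.
- by move=> _; exact: videal_vring.
Qed.

(** What matters is the order of the quantifiers: n is the degree of a as a rational function, so it
    is common to all infinite places, and regularity and vanishing of a at infinity do not depend on
    the place. *)
Lemma base_pole a : a != 0 -> exists n : int, forall P, infinite P ->
  exists u c, [/\ base a = x ^ n * u, c != 0 & videal P (u - iota c)].
Proof.
have [f [g [g0 aE]]] := base_frac a => a0.
have f0 : f != 0.
  by apply: contra_neq a0 => f0; apply/eqP; rewrite -(fmorph_eq0 base) /= aE f0 eval_at0 mul0r.
by exists ((size f)%:Z - (size g)%:Z) => P hP; rewrite aE; exact: eval_at_frac_pole.
Qed.

Lemma base_vring_videal P Q a : infinite P -> infinite Q ->
  (vring P (base a) -> vring Q (base a)) /\ (videal P (base a) -> videal Q (base a)).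
Proof.
move=> hP hQ; have [->|a0] := eqVneq a 0.
  by rewrite rmorph0; split=> _; [exact: vring0 | exact: videal0].
have [n hn] := base_pole a0.
have [u [c [E1 c0 hu]]] := hn P hP; have [v [d [E2 d0 hv]]] := hn Q hQ.
have [h1 h2] := infinite_expz n hP (residue_unit c0 hu).
have [h3 h4] := infinite_expz n hQ (residue_unit d0 hv).
split; rewrite {1}E1 E2; tauto.
Qed.

Lemma base_vring P Q a : infinite P -> infinite Q -> vring P (base a) -> vring Q (base a).
Proof. by move=> hP hQ; case: (base_vring_videal a hP hQ). Qed.

Lemma base_videal P Q a : infinite P -> infinite Q -> videal P (base a) -> videal Q (base a).
Proof. by move=> hP hQ; case: (base_vring_videal a hP hQ). Qed.

Lemma base_residue P a : infinite P -> vring P (base a) ->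
  exists c, videal P (base a - iota c).
Proof.
move=> hP; have [->|a0] := eqVneq a 0.
  by exists 0; rewrite !rmorph0 subrr; exact: videal0.
have [n hn] := base_pole a0; have [u [c [-> c0 hu]]] := hn P hP.
have [h1 h2] := infinite_expz n hP (residue_unit c0 hu).
move=> /h1; rewrite le_eqVlt => /orP [/eqP ->|/h2 h].
  by exists c; rewrite expr0z mul1r.
by exists 0; rewrite rmorph0 subr0.
Qed.

(** This is the bound 2 on the ramification index. In a relation a z^2 + b z + c = 0 two terms have
    the same value, so up to a unit of R either z is b/a, or z is c/b, or z^2 is c/a. *)
Lemma square_base R z : z != 0 -> exists a u, [/\ a != 0, vunits R u & z ^+ 2 = base a * u].
Proof.
move=> z0; have [a [b [c [abc E1]]]] := linear_relation (z ^+ 2) z 1.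
have neq0 d w : w != 0 -> (base d * w != 0) = (d != 0).
  by move=> w0; rewrite mulf_eq0 (negPf w0) orbF (fmorph_eq0 base).
have b0 d : d != 0 -> base d != 0 by rewrite (fmorph_eq0 base).
have z20 : z ^+ 2 != 0 by rewrite expf_neq0.
have [] := @three_terms _ _ _ R _ _ _ E1; first by rewrite !neq0 ?oner_eq0.
- rewrite !neq0 // => -[a0 b'0 hu].
  exists ((b / a) ^+ 2), ((base a * z ^+ 2 / (base b * z)) ^+ 2); split.
  + by rewrite expf_neq0 // mulf_neq0 ?invr_eq0.
  + exact: (vunits_expz 2 hu).
  + by rewrite rmorphXn fmorph_div /=; field; rewrite z0 !b0.
- rewrite !neq0 ?oner_eq0 // => -[c0 b'0 hu].
  exists ((c / b) ^+ 2), ((base c * 1 / (base b * z))^-1 ^+ 2); split.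
  + by rewrite expf_neq0 // mulf_neq0 ?invr_eq0.
  + exact: (vunits_expz 2 (vunitsV hu)).
  + by rewrite rmorphXn fmorph_div /=; field; rewrite z0 !b0.
- rewrite !neq0 ?oner_eq0 // => -[c0 a0 hu].
  exists (c / a), (base c * 1 / (base a * z ^+ 2))^-1; split.
  + by rewrite mulf_neq0 ?invr_eq0.
  + exact: vunitsV.
  + by rewrite fmorph_div /=; field; rewrite z0 !b0.
Qed.

Lemma vring_square R z : vring R (z ^+ 2) -> vring R z.
Proof.
have [->|z0] := eqVneq z 0; first by move=> _; exact: vring0.
move=> h; apply: contrapT => hz; have hV := videalV hz.
apply: (@videal1 _ _ _ R); rewrite (_ : 1 = z ^+ 2 * (z^-1 * z^-1)); last by field.
by apply: videalMr => //; apply: videalM => //; exact: videal_vring.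
Qed.

(** Up to a unit of P, which the inclusion makes a unit of Q, the square of z lies in K(x), where P
    and Q agree. *)
Lemma infinite_vring_sub P Q : infinite P -> infinite Q ->
  vring P `<=` vring Q -> vring Q `<=` vring P.
Proof.
move=> hP hQ sPQ z hz; have [->|z0] := eqVneq z 0; first exact: vring0.
have [a [u [a0 hu E1]]] := square_base P z0; apply: vring_square; rewrite E1.
apply: vringM; last exact: vunits_vring.
apply: (base_vring hQ hP); rewrite -(mulfK (vunits_neq0 hu) (base a)) -E1.
by apply: vringM; [exact: vringX | exact/sPQ/vunits_vring/vunitsV].
Qed.

Lemma separating_element P Q : infinite P -> infinite Q -> P <> Q ->
  exists y, videal P y /\ ~ vring Q y.
Proof.
move=> hP hQ nPQ.
have ex R S : infinite R -> infinite S -> R <> S -> exists z, vring R z /\ ~ vring S z.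
  move=> hR hS nRS; apply: contrapT => h; apply: nRS; apply/place_inj.
  have sRS : vring R `<=` vring S.
    by move=> z hz; apply: contrapT => nz; apply: h; exists z.
  by apply/seteqP; split=> //; exact: infinite_vring_sub.
have [a [aP aQ]] := ex P Q hP hQ nPQ.
have [|b [bQ bP]] := ex Q P hQ hP; first exact/nesym.
have a0 : a != 0 by apply: contra_not_neq aQ => ->; exact: vring0.
have b0 : b != 0 by apply: contra_not_neq bP => ->; exact: vring0.
exists (a / b); split; first by apply: videalMr => //; exact: videalV.
by move=> h; apply: aQ; rewrite -(divfK b0 a); exact: vringM.
Qed.

Section TwoPlaces.
Variables P Q : place iota.
Hypotheses (hP : infinite P) (hQ : infinite Q) (nPQ : P <> Q).

(** Multiplication by s removes the pole of z at Q without changing its residue at P. *)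
Lemma separating_factor z : vring P z ->
  exists s, [/\ videal P (s - 1), vring Q s & vring Q (s * z)].
Proof.
move=> Pz; have [Qz|nQz] := pselect (vring Q z).
  by exists 1; rewrite subrr mul1r; split=> //; [exact: videal0 | exact: vring1].
have [y [Py Qy]] := separating_element hP hQ nPQ.
have y0 : y != 0 by apply: contra_not_neq Qy => ->; exact: vring0.
have z0 : z != 0 by apply: contra_not_neq nQz => ->; exact: vring0.
have Pyz : videal P (y * z) by exact: videalM.
have u1 : vunits P (1 + y * z) by apply: vunitsD => //; exact: vunits1.
have n0 := vunits_neq0 u1.
have Qv : ~ vring Q (z^-1 + y).
  move=> h; apply: Qy; rewrite -(addKr z^-1 y) addrC; apply: vringB => //.
  exact/videal_vring/videalV.
(* At P the product y z vanishes, so s is 1 there. At Q one has s z = 1 / (1/z + y), whose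
   denominator has a pole because y does. *)
exists (1 + y * z)^-1; split.
- rewrite (_ : _ - 1 = - (y * z * (1 + y * z)^-1)); last by field.
  by apply/videalN/videalM => //; exact/vunits_vring/vunitsV.
- rewrite (_ : (1 + y * z)^-1 = z^-1 * (z^-1 + y)^-1); last by field; rewrite z0.
  by apply/videal_vring/videalM; [exact: videalV | exact/videal_vring/videalV].
- rewrite (_ : (1 + y * z)^-1 * z = (z^-1 + y)^-1); first exact/videal_vring/videalV.
  by field; rewrite z0.
Qed.

End TwoPlaces.

(* e separates P from Q like an idempotent: it is 1 at P and 0 at Q. *)
Definition separates P Q (e : F) : Prop :=
  [/\ infinite P, infinite Q, videal Q e & videal P (1 - e)].

Lemma separates_sym P Q e : separates P Q e -> separates Q P (1 - e).
Proof. by move=> [hP hQ Qe Pe]; split=> //; rewrite opprB addrC subrK. Qed.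

Lemma separates_exists P Q : infinite P -> infinite Q -> P <> Q -> exists e, separates P Q e.
Proof.
move=> hP hQ nPQ; have [y [Py Qy]] := separating_element hP hQ nPQ.
have u1 : vunits P (1 + y) by apply: vunitsD => //; exact: vunits1.
have n0 := vunits_neq0 u1.
exists (1 + y)^-1; split=> //.
  by apply: videalV => h; apply: Qy; rewrite -(addKr 1 y) addrC; apply/vringB/vring1.
rewrite (_ : 1 - _ = y * (1 + y)^-1); last by field.
by apply: videalM => //; exact/vunits_vring/vunitsV.
Qed.

Lemma separates_unit P Q e : separates P Q e -> vunits P e.
Proof.
move=> [_ _ _ Pe]; rewrite (_ : e = 1 + (- (1 - e))); last by ring.
by apply: vunitsD; [exact: vunits1 | exact: videalN].
Qed.

(** The element e vanishes at Q but not at P, which no element of K(x) does; so e is not in K(x),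
    and e and 1 - e form a basis of F over K(x). *)
Lemma separates_basis P Q e z : separates P Q e ->
  exists a b, z = base a * e + base b * (1 - e).
Proof.
move=> sep; have [hP hQ Qe Pe] := sep.
have ne a : e <> base a.
  move=> ea; case/vunitsP: (separates_unit sep) => _; apply.
  by rewrite ea; apply: (base_videal hQ hP); rewrite -ea.
have [a [b [c [abc E1]]]] := linear_relation z e (1 - e).
have [a0|a0] := eqVneq a 0.
  have E2 : (base b - base c) * e = - base c.
    by apply/eqP; rewrite -subr_eq0 -E1 a0 rmorph0; apply/eqP; ring.
  have [bc|nbc] := eqVneq b c.
    move: E2; rewrite bc subrr mul0r => /esym /eqP; rewrite oppr_eq0 (fmorph_eq0 base) => c0.
    by move: abc; rewrite a0 bc (eqP c0) eqxx.
  have nz : base b - base c != 0 by rewrite subr_eq0 (inj_eq (fmorph_inj base)).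
  case: (ne (- c / (b - c))); rewrite fmorph_div rmorphN rmorphB /=.
  by apply: (mulIf nz); rewrite divfK // mulrC.
have ba0 : base a != 0 by rewrite (fmorph_eq0 base).
exists (- b / a), (- c / a); apply: (mulfI ba0).
apply/eqP; rewrite -subr_eq0 -E1 !fmorph_div !rmorphN /=; apply/eqP; field.
exact: ba0.
Qed.

(** When b is not larger than a, the first coordinate governs the value at P, since 1 - e vanishes
    there. *)
Lemma separates_dominant P Q e a b : separates P Q e -> a != 0 -> vring P (base (b / a)) ->
  vunits P ((base a * e + base b * (1 - e)) / base a).
Proof.
move=> sep a0 hb; have ba0 : base a != 0 by rewrite (fmorph_eq0 base).
rewrite (_ : _ / base a = e + base (b / a) * (1 - e)); last first.
  by rewrite fmorph_div /=; field.
by apply: vunitsD; [exact: separates_unit sep | apply: videalMr => //; case: sep].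
Qed.

Lemma base_comparable P a b : a != 0 \/ b != 0 ->
  (a != 0 /\ vring P (base (b / a))) \/ (b != 0 /\ videal P (base (a / b))).
Proof.
have [->|a0] := eqVneq a 0.
  by case=> // b0; right; rewrite b0 mul0r rmorph0; split=> //; exact: videal0.
move=> _; have [h|h] := pselect (vring P (base (b / a))); first by left.
right; split; last by rewrite -[a / b]invf_div fmorphV; exact: videalV.
by apply: contra_not_neq h => ->; rewrite mul0r rmorph0; exact: vring0.
Qed.

(** The larger coordinate is visible at one of the two places, a at P and b at Q; so regularity at
    both places bounds both coordinates. *)
Lemma separates_coord P Q e a b : separates P Q e ->
  vring P (base a * e + base b * (1 - e)) -> vring Q (base a * e + base b * (1 - e)) ->
  vring P (base a) /\ vring P (base b).
Proof.
move=> sep; have [hP hQ _ _] := sep; set z := _ + _ => Pz Qz.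
have [a0b0|ab0] := pselect (a = 0 /\ b = 0).
  by have [-> ->] := a0b0; rewrite rmorph0; split; exact: vring0.
have /(base_comparable P) [[a0 hb]|[b0 ha]] : a != 0 \/ b != 0.
  by apply: contrapT => /not_orP [/negP/negPn/eqP ? /negP/negPn/eqP ?]; apply: ab0.
- have u := separates_dominant sep a0 hb.
  have ba0 : base a != 0 by rewrite (fmorph_eq0 base).
  have Pa : vring P (base a).
    have z0 : z != 0.
      by have := vunits_neq0 u; rewrite -/z mulf_eq0 invr_eq0 (negPf ba0) orbF.
    rewrite (_ : base a = z * (z / base a)^-1); last by field; rewrite ba0 z0.
    by apply: vringM => //; exact/vunits_vring/vunitsV.
  by split=> //; rewrite -(divfK a0 b) rmorphM; exact: vringM.
- have u : vunits Q (z / base b).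
    have
      := separates_dominant (separates_sym sep) b0 (base_vring hP hQ (videal_vring ha)).
    by rewrite (_ : _ + _ = z) // /z; ring.
  have bb0 : base b != 0 by rewrite (fmorph_eq0 base).
  have Qb : vring Q (base b).
    have z0 : z != 0.
      by have := vunits_neq0 u; rewrite -/z mulf_eq0 invr_eq0 (negPf bb0) orbF.
    rewrite (_ : base b = z * (z / base b)^-1); last by field; rewrite bb0 z0.
    by apply: vringM => //; exact/vunits_vring/vunitsV.
  have Pb := base_vring hQ hP Qb; split=> //.
  by rewrite -(divfK b0 a) rmorphM; apply: vringM => //; exact: videal_vring.
Qed.

Lemma separates_residue P Q e a b : separates P Q e ->
  vring P (base a) -> vring P (base b) ->
  videal P (base a * e + base b * (1 - e) - base a).
Proof.
move=> [_ _ _ Pe] ha hb; rewrite (_ : _ - _ = (base b - base a) * (1 - e)); last by ring.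
by apply: videalMr => //; exact: vringB.
Qed.

(** After multiplication by s the element is regular at Q too, so its coordinates are regular. Its
    residue at P is that of the coordinate a, which lies in K(x) and has its residue in K. *)
Lemma two_places_residue P Q z : infinite P -> infinite Q -> P <> Q -> vring P z ->
  exists c, videal P (z - iota c).
Proof.
move=> hP hQ nPQ Pz; have [e sep] := separates_exists hP hQ nPQ.
have [s [Ps Qs Qsz]] := separating_factor hP hQ nPQ Pz.
have Pz1 : videal P (z * (s - 1)) by exact: videalMr.
have Psz : vring P (s * z).
  rewrite (_ : s * z = z + z * (s - 1)); last by ring.
  by apply: vringD => //; exact: videal_vring.
have [a [b zE]] := separates_basis (s * z) sep; rewrite zE in Psz Qsz.
have [ha hb] := separates_coord sep Psz Qsz.
have [c hc] := base_residue hP ha; exists c.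
rewrite (_ : _ - _ = (s * z - base a) + (base a - iota c) - z * (s - 1)); last by ring.
by apply: videalB => //; apply: videalD => //; rewrite zE; exact: separates_residue sep _ _.
Qed.

(** If the coordinate a dominates, z has the value of a at P. If b dominates, b/z is a unit at Q
    with a pole at P, and such an element is covered by the auxiliary claim [QP]. *)
Lemma two_places_unramified P Q z : infinite P -> infinite Q -> P <> Q -> z != 0 ->
  exists a, a != 0 /\ vunits P (z / base a).
Proof.
move=> hP hQ nPQ; have [e sep] := separates_exists hP hQ nPQ.
(* If the second coordinate of w dominated, regularity at Q would make both coordinates regular, and
   w would have no pole at P. *)
have QP w : vring Q w -> ~ vring P w -> exists a, a != 0 /\ vunits P (w / base a).
  have [a [b ->]] := separates_basis w sep => Qw nPw.
  have [a0b0|ab0] := pselect (a = 0 /\ b = 0).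
    by case: nPw; have [-> ->] := a0b0; rewrite rmorph0 !mul0r addr0; exact: vring0.
  have /(base_comparable P) [[a0 hb]|[b0 ha]] : a != 0 \/ b != 0.
    by apply: contrapT => /not_orP [/negP/negPn/eqP ? /negP/negPn/eqP ?]; apply: ab0.
    by exists a; split=> //; exact: separates_dominant sep _ _.
  case: nPw; set w' := _ + _.
  have u : vunits Q (w' / base b).
    have
      := separates_dominant (separates_sym sep) b0 (base_vring hP hQ (videal_vring ha)).
    by rewrite (_ : _ + _ = w') // /w'; ring.
  have bb0 : base b != 0 by rewrite (fmorph_eq0 base).
  have w0 : w' != 0.
    by have := vunits_neq0 u; rewrite mulf_eq0 invr_eq0 (negPf bb0) orbF.
  have Qb : vring Q (base b).
    rewrite (_ : base b = w' * (w' / base b)^-1); last by field; rewrite bb0 w0.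
    by apply: vringM => //; exact/vunits_vring/vunitsV.
  have Pb := base_vring hQ hP Qb.
  have Pa : vring P (base a).
    by rewrite -(divfK b0 a) rmorphM; apply: vringM => //; exact: videal_vring.
  rewrite /w'; apply: vringD; apply: vringM => //.
    exact/vunits_vring/(separates_unit sep).
  by case: sep => _ _ _ /videal_vring.
have [a [b ->]] := separates_basis z sep => z0.
have /(base_comparable P) [[a0 hb]|[b0 ha]] : a != 0 \/ b != 0.
  apply: contrapT => /not_orP [/negP/negPn/eqP a0 /negP/negPn/eqP b0].
  by case/eqP: z0; rewrite a0 b0 rmorph0 !mul0r addr0.
  by exists a; split=> //; exact: separates_dominant sep _ _.
set z' := _ + _ in z0 *; have bb0 : base b != 0 by rewrite (fmorph_eq0 base).
have u : vunits Q (z' / base b).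
  have
      := separates_dominant (separates_sym sep) b0 (base_vring hP hQ (videal_vring ha)).
  by rewrite (_ : _ + _ = z') // /z'; ring.
have m : videal P (z' / base b).
  rewrite (_ : _ / _ = base (a / b) * e + (1 - e)); last first.
    by rewrite fmorph_div /= /z'; field.
  apply: videalD; last by case: sep.
  by apply: videalM => //; exact/vunits_vring/(separates_unit sep).
have [c [c0 hc]] := QP _ (vunits_vring (vunitsV u)) (videal_vringV (vunits_neq0 u) m).
have bc0 : base c != 0 by rewrite (fmorph_eq0 base).
exists (b / c); split; first by rewrite mulf_neq0 ?invr_eq0.
rewrite (_ : _ / _ = ((z' / base b)^-1 / base c)^-1); first exact: vunitsV.
by rewrite fmorph_div /=; field; rewrite z0 bb0 bc0.
Qed.

Lemma two_places_uniformizer P Q : infinite P -> infinite Q -> P <> Q -> uniformizer P x^-1.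
Proof.
move=> hP hQ nPQ; split=> [|z z0]; first exact: videalV.
have [a [a0 hu]] := two_places_unramified hP hQ nPQ z0.
have [n hn] := base_pole a0; have [u [c [E1 c0 hc]]] := hn P hP.
exists (- n), (u * (z / base a)); split.
  by apply: vunitsM => //; exact: residue_unit hc.
by rewrite exprz_inv opprK mulrA -E1 mulrCA divff ?mulr1 // (fmorph_eq0 base).
Qed.

(** An element regular at P and Q has regular coordinates, so at R, where e is 1 as at P, it has the
    residue of its first coordinate, as at P. For z regular at P, both s and s z are such elements,
    and s is 1 at P, hence a unit at R; so z = (s z) / s is regular at R. *)
Lemma separates_vring_sub P Q R e : separates P Q e -> P <> Q -> infinite R ->
  vring R e -> videal R (1 - e) -> vring P `<=` vring R.
Proof.
move=> sep nPQ hR Re Re1; have [hP hQ _ _] := sep.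
have sub w : vring P w -> vring Q w -> exists a,
    [/\ vring R w, videal P (w - base a) & videal R (w - base a)].
  move=> Pw Qw; have [a [b wE]] := separates_basis w sep; rewrite wE in Pw Qw.
  have [ha hb] := separates_coord sep Pw Qw.
  have [Ra Rb] := (base_vring hP hR ha, base_vring hP hR hb).
  exists a; rewrite wE; split; last first.
  - rewrite (_ : _ - _ = (base b - base a) * (1 - e)); last by ring.
    by apply: videalMr => //; exact: vringB.
  - exact: separates_residue sep _ _.
  - by apply: vringD; apply: vringM => //; exact: videal_vring.
move=> z Pz; have [s [Ps Qs Qsz]] := separating_factor hP hQ nPQ Pz.
have Ps' : vring P s.
  by rewrite -(subrK 1 s); apply: vringD; [exact: videal_vring | exact: vring1].
have Psz : vring P (s * z) by exact: vringM.
have [a [_ Pa Ra]] := sub s Ps' Qs; have [_ [Rsz _ _]] := sub _ Psz Qsz.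
have Pa1 : videal P (base (a - 1)).
  rewrite rmorphB rmorph1 /= (_ : _ - _ = (s - 1) - (s - base a)); last by ring.
  exact: videalB.
have us : vunits R s.
  have Ra1 := base_videal hP hR Pa1.
  rewrite (_ : s = 1 + ((s - base a) + base (a - 1))); last by rewrite rmorphB rmorph1 /=; ring.
  by apply: vunitsD; [exact: vunits1 | exact: videalD].
rewrite -(mulKf (vunits_neq0 us) z); apply: vringM => //.
exact/vunits_vring/vunitsV.
Qed.

Lemma two_infinite_places P Q R : infinite P -> infinite Q -> P <> Q -> infinite R ->
  R = P \/ R = Q.
Proof.
move=> hP hQ nPQ hR; have [e sep] := separates_exists hP hQ nPQ.
have [_ _ Qe Pe] := sep; have Pe1 := vunits_vring (separates_unit sep).
have Qe1 : vring Q (1 - e) by apply: vringB; [exact: vring1 | exact: videal_vring].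
(* The product e (1 - e) vanishes at P and Q, so its coordinates vanish at infinity, also at R.
   Modulo R the element e is therefore 0 or 1, which decides between Q and P. *)
have [a [b eE]] := separates_basis (e * (1 - e)) sep.
have Pee : videal P (e * (1 - e)) by exact: videalMr.
have Qee : videal Q (e * (1 - e)) by exact: videalM.
have [ha hb] : vring P (base a) /\ vring P (base b).
  by apply: (separates_coord sep); rewrite -eE; exact: videal_vring.
have [Ra Rb] := (base_vring hP hR ha, base_vring hP hR hb).
(* The coordinates give e^2 = (1 - a + b) e - b with coefficients regular at R; divided by e^2, this
   would put 1 into the maximal ideal if e had a pole. *)
have Re : vring R e.
  apply: contrapT => nRe; have eV := videalV nRe.
  have e0 : e != 0 by apply: contra_not_neq nRe => ->; exact: vring0.
  apply: (@videal1 _ _ _ R).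
  rewrite (_ : 1 = (1 - base a + base b) * e^-1 - base b * (e^-1 * e^-1)).
    apply: videalB; apply: videalMr => //.
      by apply: vringD => //; apply: vringB => //; exact: vring1.
    by apply: videalM => //; exact: videal_vring.
  apply: (mulfI e0); apply: (mulfI e0); rewrite mulr1.
  rewrite (_ : e * (e * _) = e - (base a * e + base b * (1 - e)) ); last by field.
  by rewrite -eE; ring.
have Pa : videal P (base a).
  rewrite (_ : base a = e * (1 - e) - (e * (1 - e) - base a)); last by ring.
  by apply: videalB => //; rewrite [X in X - _]eE; exact: separates_residue sep _ _.
have Qb : videal Q (base b).
  rewrite (_ : base b = e * (1 - e) - (e * (1 - e) - base b)); last by ring.
  apply: videalB => //; rewrite [X in X - _]eE.
  have := separates_residue (separates_sym sep) (base_vring hP hQ hb) (base_vring hP hQ ha).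
  by rewrite subKr [X in videal Q (X - _)]addrC.
have Ree : videal R (e * (1 - e)).
  rewrite eE; apply: videalD; apply: videalM => //.
  - exact: (base_videal hP hR).
  - exact: (base_videal hQ hR).
  - by apply: vringB => //; exact: vring1.
have eqR S : infinite S -> vring S `<=` vring R -> R = S.
  by move=> hS sSR; apply/place_inj/seteqP; split=> //; exact: infinite_vring_sub.
have [me|me] := pselect (videal R e).
  right; apply: eqR => //; apply: (separates_vring_sub (separates_sym sep) (nesym nPQ) hR).
    by apply: vringB => //; exact: vring1.
  by rewrite subKr.
left; apply: eqR => //; apply: (separates_vring_sub sep nPQ hR Re).
have ue : vunits R e by apply/vunitsP.
rewrite -(mulKf (vunits_neq0 ue) (1 - e)); apply: videalMr => //.
exact/vunits_vring/vunitsV.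
Qed.

(** * Integral elements, constants, and discreteness of finite places *)

Definition integral_x z : Prop := integralOver ev z.

Lemma integral_vring R z : integral_x z -> vring R x -> vring R z.
Proof.
move=> iz hx; apply: vring_integral iz => f.
exact: vring_eval.
Qed.

(** The integral closure of K[x] is the intersection of the valuation rings containing x, again by
    Chevalley. *)
Lemma integral_xP z : (forall R, vring R x -> vring R z) -> integral_x z.
Proof.
move=> h; apply: contrapT => nz.
have [|R [hR nR]] := @place_avoiding _ _ iota _ _ z _ nz.
  by move=> c; exists c%:P; exact: eval_atC.
by apply: nR; apply: h; rewrite -(eval_atX iota x); exact: hR.
Qed.

(** If z - c vanishes at P and is not 0, its inverse has a pole at P; but that inverse is algebraic
    over K, and algebraic elements have no poles. *)
Lemma algebraic_const P Q z : infinite P -> infinite Q -> P <> Q ->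
  algebraicOver iota z -> exists c, z = iota c.
Proof.
move=> hP hQ nPQ az.
have Pv w : algebraicOver iota w -> vring P w.
  by move/integral_algebraic => iw; apply: vring_integral iw => c; exact: vring_const.
have [c hc] := two_places_residue hP hQ nPQ (Pv z az); exists c.
apply/eqP; rewrite -subr_eq0; apply/negPn/negP => n0.
apply: (videal_vringV n0 hc); apply/Pv/algebraic_inv/algebraic_sub => //.
exact: algebraic_id.
Qed.

Lemma integral_const P Q z : infinite P -> infinite Q -> P <> Q ->
  integral_x z -> vring P z -> vring Q z -> exists c, z = iota c.
Proof.
move=> hP hQ nPQ iz Pz Qz; apply: (algebraic_const hP hQ nPQ); apply/integral_algebraic.
apply: contrapT => nz.
have [|R [_ nR]] := @place_avoiding _ _ iota _ _ z _ nz; first by move=> c; exists c.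
have hR : infinite R by move=> /(integral_vring iz).
by have [RP|RQ] := two_infinite_places hP hQ nPQ hR; apply: nR; rewrite ?RP ?RQ.
Qed.

Lemma vunits_square R z : vunits R (z ^+ 2) -> vunits R z.
Proof.
move=> [z20 [h h']]; split; first by move: z20; rewrite expf_eq0.
by split; apply: vring_square; rewrite ?exprVn.
Qed.

(** Let p generate the prime of K[x] below R. Every z^2 is a power of p up to a unit. If some
    exponent is odd, a quotient t of z by a power of p has t^2 = p up to a unit, and t is a
    uniformizer; if all are even, p is one. *)
Lemma finite_discrete R : vring R x -> discrete_place R.
Proof.
move=> hx.
(* If no polynomial vanished at R, all of K(x) would be regular there, so all squares of F up to
   units, and R would be all of F. *)
have [f [f0 hf]] : exists f, f != 0 /\ videal R (ev f).
  apply: contrapT => h; have [z nz] := vring_proper R.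
  have z0 : z != 0 by apply: contra_not_neq nz => ->; exact: vring0.
  have uev f : f != 0 -> vunits R (ev f).
    by move=> f0; apply/vunitsP; split=> [|hf]; [exact: vring_eval | apply: h; exists f].
  have [a [u [a0 hu E1]]] := square_base R z0; apply/nz/vring_square; rewrite E1.
  apply: vringM; last exact: vunits_vring.
  have [f [g [g0 ->]]] := base_frac a.
  by apply: vringM; [exact: vring_eval | exact/vunits_vring/vunitsV/uev].
have [p hp] := place_poly_exists hx f0 hf; have [p0 mp _] := hp.
have pi0 := x_transc p0.
have sq z : z != 0 -> exists (n : int) u, vunits R u /\ z ^+ 2 = ev p ^ n * u.
  move=> z0; have [a [u [a0 hu E1]]] := square_base R z0.
  have [g [h [h0 aE]]] := base_frac a.
  have g0 : g != 0.
    by apply: contra_neq a0 => g0; apply/eqP; rewrite -(fmorph_eq0 base) /= aE g0 eval_at0 mul0r.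
  have [m [v [hv E2]]] := eval_at_place_poly hx hp g0.
  have [n [w [hw E3]]] := eval_at_place_poly hx hp h0.
  exists (m%:Z - n%:Z), (v / w * u); split; first by apply: vunitsM => //; apply/vunitsM/vunitsV.
  rewrite E1 aE E2 E3 expfzDr // -exprnN -exprnP.
  by field; rewrite (vunits_neq0 hw) expf_neq0.
have par (n : int) : exists k : int, n = k + k \/ n = k + k + 1.
  exists (n %/ 2)%Z; have := divz_eq n 2.
  by have := @modz_ge0 n 2 isT; have := @ltz_pmod n 2 isT; lia.
have [[z [k [u [z0 hu E1]]]]|even] :=
  pselect (exists z (k : int) u, [/\ z != 0, vunits R u & z ^+ 2 = ev p ^ (k + k + 1) * u]).
  pose t := z / ev p ^ k; have pk0 := expfz_neq0 k pi0.
  have t0 : t != 0 by rewrite mulf_neq0 ?invr_eq0.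
  have t2 : t ^+ 2 = ev p * u.
    by rewrite /t expr_div_n E1 !expfzDr // expr1z; field.
  have mt : videal R t.
    apply/videalP; right=> h; apply: (@videal1 _ _ _ R).
    rewrite (_ : 1 = t ^+ 2 * (t^-1 * t^-1)); last by field.
    by apply: videalM; [rewrite t2; apply: videalM => //; exact: vunits_vring | exact: vringM].
  exists t; split=> // w w0; have [n [v [hv E2]]] := sq w w0.
  exists n, (w / t ^ n); split; last by rewrite mulrC divfK // expfz_neq0.
  apply: vunits_square; rewrite expr_div_n E2.
  have -> : (t ^ n) ^+ 2 = ev p ^ n * u ^ n.
    by rewrite -expfzMl -t2 !exprnP exprzAC.
  have pn0 := expfz_neq0 n pi0; have un0 := expfz_neq0 n (vunits_neq0 hu).
  rewrite (_ : _ / _ = v * (u ^ n)^-1); last by field; rewrite pn0 un0.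
  by apply: vunitsM => //; apply/vunitsV/vunits_expz.
exists (ev p); split=> // z z0; have [n [u [hu E1]]] := sq z z0.
have [k [nk|nk]] := par n; last by case: even; exists z, k, u; rewrite -nk.
have pk0 := expfz_neq0 k pi0.
exists k, (z / ev p ^ k); split; last by rewrite mulrC divfK.
apply: vunits_square; rewrite expr_div_n E1 nk expfzDr //.
by rewrite (_ : _ / _ = u) //; field.
Qed.

End QuadraticExtension.

(** * Units and sums of units *)

Section UnitSums.
Variables (K L : fieldType) (F : fieldExtType L) (iota : {rmorphism K -> F}) (x : F).
Local Notation ev := (eval_at iota x).
Implicit Types (P Q R : place iota) (z u v w : F).
Hypotheses (F_quadratic : (\dim {: F} = 2)%N)
  (x_transc : forall f, f != 0 -> ev f != 0)
  (base_frac : forall a : L, exists f g, g != 0 /\ base F a = ev f / ev g).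
Local Notation base := (base F).
Local Notation infinite := (infinite x).
Local Notation integral := (integral_x iota x).

Definition unit_x u : Prop := [/\ u != 0, integral u & integral u^-1].

Definition zmod_set (S : set F) : Prop := S 0 /\ forall z w, S z -> S w -> S (z - w).

Lemma zmod_setD (S : set F) (c d : F) : zmod_set S -> S c -> S d -> S (c + d).
Proof.
by move=> [S0 SB] Sa Sb; rewrite -[d]opprK; apply: (SB) => //; rewrite -sub0r; exact: SB.
Qed.

Lemma integralM z w : integral z -> integral w -> integral (z * w).
Proof. exact: integral_mul. Qed.

Lemma integralB z w : integral z -> integral w -> integral (z - w).
Proof. exact: integral_sub. Qed.

Lemma integralC c : integral (iota c).
Proof. by rewrite -(eval_atC iota x); exact: integral_id. Qed.

Lemma integral_gen : integral x.
Proof. by rewrite /integral_x -{2}(eval_atX iota x); exact: integral_id. Qed.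

Lemma integralX z n : integral z -> integral (z ^+ n).
Proof.
move=> hz; elim: n => [|n IH]; first by rewrite expr0; exact: integral1.
by rewrite exprS; exact: integralM.
Qed.

Lemma unit_xM u v : unit_x u -> unit_x v -> unit_x (u * v).
Proof.
move=> [u0 iu iuV] [v0 iv ivV].
by split; [rewrite mulf_neq0 | exact: integralM | rewrite invfM; exact: integralM].
Qed.

Lemma unit_xV u : unit_x u -> unit_x u^-1.
Proof. by move=> [u0 iu iuV]; split; rewrite ?invr_eq0 ?invrK. Qed.

Lemma unit_x_const c : c != 0 -> unit_x (iota c).
Proof. by move=> c0; split; rewrite ?fmorph_eq0 -?fmorphV //; exact: integralC. Qed.

Lemma unit_x_expz u (n : int) : unit_x u -> unit_x (u ^ n).
Proof.
have X v k : unit_x v -> unit_x (v ^+ k).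
  move=> hv; elim: k => [|k IH]; last by rewrite exprS; exact: unit_xM.
  by rewrite expr0 -(rmorph1 iota); apply: unit_x_const; exact: oner_neq0.
by move=> hu; case: n => n; [exact: X | rewrite NegzE -exprnN; apply/unit_xV/X].
Qed.

(** * Units in the presence of two infinite places *)

Section TwoInfinitePlaces.
Variables P Q : place iota.
Hypotheses (hP : infinite P) (hQ : infinite Q) (nPQ : P <> Q).

Lemma discreteP : discrete_place P.
Proof. by exists x^-1; exact: (two_places_uniformizer F_quadratic base_frac hP hQ nPQ). Qed.

Lemma val_at_x : val_at P x = -1.
Proof.
have ux := two_places_uniformizer F_quadratic base_frac hP hQ nPQ.
by have := val_at_uniformizer (-1) ux (vunits1 P); rewrite exprN1 invrK mulr1.
Qed.

(** Either u or its inverse is regular at Q as well; being integral and regular at both infinite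
    places, it is constant. *)
Lemma unit_val0 u : unit_x u -> val_at P u = 0 -> exists2 c, c != 0 & u = iota c.
Proof.
move=> [u0 iu iuV] vu; have [_ [Pu PuV]] := val_at_eq0 discreteP u0 vu.
have const := integral_const F_quadratic base_frac hP hQ nPQ.
case: (vring_total Q u) => [Qu|QuV].
  have [c uc] := const u iu Pu Qu; exists c => //.
  by apply: contra_neq u0 => c0; rewrite uc c0 rmorph0.
have [c uc] := const _ iuV PuV QuV; exists c^-1; last by rewrite fmorphV -uc invrK.
by rewrite invr_eq0; apply: contra_neq u0 => c0; rewrite -[u]invrK uc c0 rmorph0 invr0.
Qed.

(** If u did not vanish at Q, its inverse would be regular at both infinite places and hence
    constant. *)
Lemma unit_pole_zero u : unit_x u -> val_at P u < 0 -> videal Q u.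
Proof.
move=> [u0 iu iuV] vu; apply: contrapT => nQ.
have QuV : vring Q u^-1.
  by apply: contrapT => nV; apply: nQ; rewrite -[u]invrK; exact: videalV.
have PuV : vring P u^-1.
  by apply/(val_at_ge0 discreteP); rewrite ?invr_eq0 // val_atV //; [lia | exact: discreteP].
have [c uc] := integral_const F_quadratic base_frac hP hQ nPQ iuV PuV QuV.
have c0 : c != 0.
  by apply: contra_neq u0 => c0; rewrite -[u]invrK uc c0 rmorph0 invr0.
move: vu; rewrite -[u]invrK val_atV ?invr_eq0 //; last exact: discreteP.
by rewrite uc (val_at_unit discreteP) ?oppr0 ?ltxx //; exact: vunits_const.
Qed.

Definition generated : Prop := forall S : set F, zmod_set S ->
  (forall u, unit_x u -> S u) -> forall w, integral w -> S w.

(* The units are the c * eps ^ n for a unit eps with a pole of minimal order d at P.  Since x is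
   a K-combination of powers of eps and has a simple pole at P, d divides 1. *)
Lemma unit_simple_pole u : generated -> unit_x u -> ~ vring P u ->
  exists z, unit_x z /\ val_at P z = -1.
Proof.
move=> gen hu nu; have dP := discreteP.
pose ok d := `[< (0 < d)%N /\ exists v, unit_x v /\ val_at P v = - d%:Z >].
have ex : exists d, ok d.
  have [u0 _ _] := hu.
  have vu : val_at P u < 0 by rewrite ltNge; apply/negP => /(val_at_ge0 dP u0).
  exists `|val_at P u|%N; apply/asboolP; split; first by lia.
  by exists u; split=> //; lia.
case: (ex_minnP ex) => d /asboolP [d0 [e [he ve]]] dmin.
have [e0 ie ieV] := he.
have units v : unit_x v -> exists2 c, c != 0 & exists n : int, v = iota c * e ^ n.
  (* As e has order -d at P, the unit v e^q has the order of v modulo d; a nonzero remainder would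
     make its inverse a unit with a pole smaller than d. *)
  move=> hv; have [v0 _ _] := hv; set q := (val_at P v %/ d%:Z)%Z.
  have hv' : unit_x (v * e ^ q) by apply/unit_xM/unit_x_expz.
  have vE : val_at P (v * e ^ q) = (val_at P v %% d%:Z)%Z.
    rewrite val_atM ?expfz_neq0 // val_at_expz // ve [in LHS](divz_eq (val_at P v) d%:Z).
    by rewrite -/q; ring.
  have [r0|r0] := eqVneq (val_at P v %% d%:Z)%Z 0.
    have [c c0 cE] := unit_val0 hv' (etrans vE r0); exists c => //; exists (- q).
    by rewrite -cE -mulrA -expfzDr // subrr expr0z mulr1.
  have rge : 0 <= (val_at P v %% d%:Z)%Z by rewrite modz_ge0 //; lia.
  have rlt : (val_at P v %% d%:Z)%Z < d%:Z by apply: ltz_pmod; lia.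
  have : (d <= `|(val_at P v %% d%:Z)%Z|)%N.
    apply: dmin; apply/asboolP; split; first by lia.
    exists (v * e ^ q)^-1; split; first exact: unit_xV.
    by rewrite val_atV ?vE //; [lia | case: hv'].
  by lia.
pose ee := eval_at iota e.
pose S : set F := [set w | exists f (n : nat), w = ee f * e^-1 ^+ n].
have zS : zmod_set S.
  split=> [|_ _ [f [m ->]] [g [n ->]]].
    by exists 0, 0%N; rewrite /ee eval_at0 mul0r.
  exists (f * 'X^n - g * 'X^m), (m + n)%N.
  rewrite /ee eval_atB !eval_atM !eval_atXn !eval_atX exprD !exprVn.
  by field; rewrite !expf_neq0.
have Su v : unit_x v -> S v.
  move=> /units [c c0 [[n|n] ->]].
    by exists (c%:P * 'X^n), 0%N; rewrite /ee eval_atM eval_atXn eval_atC eval_atX expr0 mulr1.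
  by exists c%:P, n.+1; rewrite /ee eval_atC NegzE -exprnN exprVn.
have [f [n xE]] := gen S zS Su x integral_gen.
have x0 : x != 0 by have := x_transc (negbT (polyX_eq0 K)); rewrite eval_atX.
have f0 : f != 0 by apply: contra_neq x0 => f0; rewrite xE f0 /ee eval_at0 mul0r.
have neP : ~ vring P e by move=> /(val_at_ge0 dP e0); rewrite ve; lia.
have [v vE hv] := eval_at_pole neP f0.
have lf0 : lead_coef f != 0 by rewrite lead_coef_eq0.
have uv := residue_unit lf0 hv; have v0 := vunits_neq0 uv.
have := val_at_x; rewrite xE /ee vE exprVn val_atM ?mulf_neq0 ?invr_eq0 ?expf_neq0 //.
rewrite val_atM ?expf_neq0 // val_atV ?expf_neq0 // !val_atX // (val_at_unit dP uv) ve => h.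
exists e; split=> //; rewrite ve.
have h1 : d%:Z * ((size f).-1%:Z - n%:Z) = 1 by rewrite -[RHS]opprK -h; ring.
have : (d %| 1)%N.
  rewrite -[(d %| 1)%N]/(d%:Z %| 1)%Z; apply/dvdzP.
  by exists ((size f).-1%:Z - n%:Z); rewrite mulrC h1.
by rewrite dvdn1 => /eqP ->.
Qed.

End TwoInfinitePlaces.


Section PoleReduction.
Variables P Q : place iota.
Hypotheses (hP : infinite P) (hQ : infinite Q) (nPQ : P <> Q).
Variable z : F.
Hypotheses (z0 : z != 0) (vz : val_at P z = -1) (Qz : videal Q z).

(** Induction on a bound for the pole order: the residue c of w / z^(m+1) at P gives the term c
    z^(m+1), which lowers the pole of w and is regular at Q because z vanishes there. The set S
    records properties of the correcting sum d. *)
Lemma pole_reduction (S : set F) w : zmod_set S ->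
  (forall c (n : nat), S (iota c * z ^+ n)) ->
  exists d, [/\ S d, vring Q d & vring P (w - d)].
Proof.
move=> zS Sz; have dP := discreteP hP hQ nPQ.
have [m hm] : exists m : nat, vring P (w * z^-1 ^+ m).
  have [->|w0] := eqVneq w 0; first by exists 0%N; rewrite mul0r; exact: vring0.
  exists `|val_at P w|%N; apply/(val_at_ge0 dP).
    by rewrite mulf_neq0 // expf_neq0 // invr_eq0.
  rewrite val_atM // ?expf_neq0 ?invr_eq0 // val_atX ?invr_eq0 // val_atV // vz opprK mul1r.
  by lia.
elim: m w hm => [|m IH] w hm.
  exists 0; case: zS => S0 _; split=> //; first exact: vring0.
  by rewrite subr0 -[w]mulr1 -(expr0 z^-1).
have [c hc] := two_places_residue F_quadratic base_frac hP hQ nPQ hm.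
pose w1 := w - iota c * z ^+ m.+1.
have h1 : videal P (w1 * z^-1 ^+ m.+1).
  rewrite (_ : w1 * _ = w * z^-1 ^+ m.+1 - iota c) // /w1 mulrBl exprVn mulfK //.
  by rewrite expf_neq0.
have [|d [Sd Qd Pd]] := IH w1.
  have [->|w10] := eqVneq w1 0; first by rewrite mul0r; exact: vring0.
  have n0 k : w1 * z^-1 ^+ k != 0 by rewrite mulf_neq0 // expf_neq0 // invr_eq0.
  apply/(val_at_ge0 dP (n0 m)); move/(val_at_gt0 dP (n0 m.+1)): h1.
  rewrite !val_atM // ?expf_neq0 ?invr_eq0 // !val_atX ?invr_eq0 // !val_atV // vz.
  by lia.
exists (iota c * z ^+ m.+1 + d); split.
- by apply: zmod_setD.
- apply: vringD => //; apply: vringM; first exact: vring_const.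
  exact/vringX/videal_vring.
- by rewrite opprD addrA.
Qed.

End PoleReduction.

Definition opposite_poles P Q z z' : Prop :=
  [/\ infinite P, infinite Q & P <> Q] /\
  [/\ z != 0, integral z, val_at P z = -1 & videal Q z] /\
  [/\ z' != 0, integral z', val_at Q z' = -1 & videal P z'].

(** * Consequences of a pair of opposite simple poles *)

Section OppositePoles.
Variables (P Q : place iota) (z z' : F).
Hypothesis opp : opposite_poles P Q z z'.

Let hP : infinite P. Proof. by case: opp => -[]. Qed.
Let hQ : infinite Q. Proof. by case: opp => -[]. Qed.
Let nPQ : P <> Q. Proof. by case: opp => -[]. Qed.
Let z0 : z != 0. Proof. by case: opp => _ [] []. Qed.
Let z'0 : z' != 0. Proof. by case: opp => _ [] _ []. Qed.
Let iz : integral z. Proof. by case: opp => _ [] []. Qed.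
Let iz' : integral z'. Proof. by case: opp => _ [] _ []. Qed.
Let vz : val_at P z = -1. Proof. by case: opp => _ [] []. Qed.
Let vz' : val_at Q z' = -1. Proof. by case: opp => _ [] _ []. Qed.
Let Qz : videal Q z. Proof. by case: opp => _ [] []. Qed.
Let Pz' : videal P z'. Proof. by case: opp => _ [] _ []. Qed.

Let dP : discrete_place P. Proof. exact: discreteP hP hQ nPQ. Qed.
Let dQ : discrete_place Q. Proof. exact: discreteP hQ hP (nesym nPQ). Qed.

(** The pole of each factor is simple, so the zero of the other factor cancels it. *)
Lemma opposite_poles_product : exists2 c, c != 0 & z * z' = iota c.
Proof.
have [||c cE] := integral_const F_quadratic base_frac hP hQ nPQ (integralM iz iz').
- apply/(val_at_ge0 dP); rewrite ?mulf_neq0 // val_atM // vz.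
  by move/(val_at_gt0 dP z'0): Pz'; lia.
- apply/(val_at_ge0 dQ); rewrite ?mulf_neq0 // val_atM // vz'.
  by move/(val_at_gt0 dQ z0): Qz; lia.
exists c => //; have : z * z' != 0 by rewrite mulf_neq0.
by apply: contra_neq => c0; rewrite cE c0 rmorph0.
Qed.

Lemma opposite_poles_unit : unit_x z.
Proof.
have [c c0 zz] := opposite_poles_product; split=> //.
rewrite (_ : z^-1 = iota c^-1 * z'); first by apply: integralM => //; exact: integralC.
apply: (mulfI z0); rewrite mulrCA zz divff // fmorphV mulVf //.
by rewrite fmorph_eq0.
Qed.

(** The pole of w at P is removed with powers of z, the pole at Q with powers of z', and the rest is
    constant. The condition on S is restricted to c != 0 so that it concerns units only. *)
Lemma opposite_poles_span (S : set F) : zmod_set S ->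
  (forall c (n : int), c != 0 -> S (iota c * z ^ n)) -> forall w, integral w -> S w.
Proof.
move=> zS Sz w iw; have [k k0 zz] := opposite_poles_product.
have Sz' c (n : int) : S (iota c * z ^ n).
  have [->|c0] := eqVneq c 0; first by rewrite rmorph0 mul0r; case: zS.
  exact: Sz.
(* Integrality of the corrections is carried along, since the remainder has to be integral to be
   constant. *)
pose T : set F := [set d | S d /\ integral d].
have zT : zmod_set T.
  split; first by split; [case: zS | exact: integral0].
  by move=> a b [Sa ia] [Sb ib]; split; [case: zS => _; apply | exact: integralB].
have [d [[Sd id] Qd Pd]] : exists d, [/\ T d, vring Q d & vring P (w - d)].
  apply: (pole_reduction hP hQ nPQ z0 vz Qz _ zT) => c n; split.
    by rewrite exprnP; exact: Sz'.
  by apply: integralM; [exact: integralC | exact: integralX].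
have [d' [[Sd' id'] Pd' Qd']] : exists d, [/\ T d, vring P d & vring Q (w - d)].
  apply: (pole_reduction hQ hP (nesym nPQ) z'0 vz' Pz' _ zT) => c n; split.
    (* The powers of z' supply the negative powers of z. *)
    rewrite (_ : z' = iota k * z^-1); last by rewrite -zz mulrAC divff // mul1r.
    by rewrite exprMn mulrA -rmorphXn -rmorphM exprVn exprnN; exact: Sz'.
  by apply: integralM; [exact: integralC | exact: integralX].
have [||c cE] := integral_const F_quadratic base_frac hP hQ nPQ (integralB (integralB iw id) id').
- exact: vringB.
- by rewrite addrAC; exact: vringB.
rewrite -(subrK d w); apply: zmod_setD => //; rewrite -(subrK d' (w - d)); apply: zmod_setD => //.
by rewrite cE -[iota c]mulr1 -(expr0z z).
Qed.

Lemma opposite_poles_units u : unit_x u ->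
  exists c (n : int), c != 0 /\ u = iota c * z ^ n.
Proof.
move=> hu; have [u0 _ _] := hu.
have hv : unit_x (u * z ^ val_at P u).
  by apply: unit_xM => //; apply: unit_x_expz; exact: opposite_poles_unit.
have [|c c0 cE] := unit_val0 hP hQ nPQ hv.
  by rewrite val_atM ?expfz_neq0 // val_at_expz // vz mulN1r subrr.
exists c, (- val_at P u); split=> //.
by rewrite -cE -mulrA -expfzDr // subrr expr0z mulr1.
Qed.

Let z_pole : ~ vring P z.
Proof. by move=> /(val_at_ge0 dP z0); rewrite vz. Qed.

Lemma opposite_poles_transc f : f != 0 -> eval_at iota z f != 0.
Proof.
move=> f0; have [u -> hu] := eval_at_pole z_pole f0.
rewrite mulf_neq0 ?expf_neq0 //; apply: vunits_neq0 (residue_unit _ hu).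
by rewrite lead_coef_eq0.
Qed.

(** The field K(z) contains O_F, hence K(x). Moreover z is not in K(x), as it has a pole at P and a
    zero at Q, so 1 and z span F over K(x). *)
Lemma opposite_poles_generate w :
  exists f g, g != 0 /\ w = eval_at iota z f / eval_at iota z g.
Proof.
pose ez := eval_at iota z.
have ez0 f : f != 0 -> ez f != 0 by exact: opposite_poles_transc.
pose G : set F := [set w | exists f g, g != 0 /\ w = ez f / ez g].
have GM a b : G a -> G b -> G (a * b).
  move=> [f [g [g0 ->]]] [h [k [k0 ->]]]; exists (f * h), (g * k).
  by rewrite mulf_neq0 // /ez !eval_atM mulf_div.
have GB a b : G a -> G b -> G (a - b).
  move=> [f [g [g0 ->]]] [h [k [k0 ->]]]; exists (f * k - h * g), (g * k).
  rewrite mulf_neq0 // /ez eval_atB !eval_atM; split=> //.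
  by field; rewrite ez0 // ez0.
have GV a : G a -> G a^-1.
  move=> [f [g [g0 ->]]]; have [->|f0] := eqVneq f 0.
    by exists 0, 1; rewrite oner_neq0 /ez eval_at0 !mul0r invr0.
  by exists g, f; rewrite invf_div.
have GC c : G (iota c).
  by exists c%:P, 1; rewrite oner_neq0 /ez eval_atC eval_at1 divr1.
have Gz : G z by exists 'X, 1; rewrite oner_neq0 /ez eval_atX eval_at1 divr1.
have zG : zmod_set G by split=> //; rewrite -(rmorph0 iota); exact: GC.
have GX a n : G a -> G (a ^+ n).
  move=> Ga; elim: n => [|n IH]; last by rewrite exprS; exact: GM.
  by rewrite expr0 -(rmorph1 iota); exact: GC.
have Gint v : integral v -> G v.
  apply: (opposite_poles_span zG) => c n _; apply: GM => //.
  by case: n => n; [exact: GX | rewrite NegzE -exprnN; apply/GV/GX].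
have Gbase a : G (base a).
  have [f [g [g0 ->]]] := base_frac a.
  by apply: GM; [|apply: GV]; apply: Gint; exact: (integral_id ev).
have nz a : z <> base a.
  move=> za; case: z_pole; rewrite za; apply: videal_vring.
  by apply: (base_videal base_frac hQ hP); rewrite -za.
have [a [b [c [abc E1]]]] := linear_relation F_quadratic 1 z w.
have b0 d : d != 0 -> base d != 0 by rewrite (fmorph_eq0 base).
have [c0|c0] := eqVneq c 0.
  move: E1 abc; rewrite c0 rmorph0 mul0r addr0 mulr1 eqxx orbF.
  have [-> + |b'0 E1 _] := eqVneq b 0.
    by rewrite rmorph0 mul0r addr0 => /eqP; rewrite (fmorph_eq0 base) => ->.
  case: (nz (- a / b)); rewrite fmorph_div rmorphN /=; apply: (mulIf (b0 _ b'0)).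
  by rewrite divfK ?b0 //; apply/eqP; rewrite -addr_eq0 mulrC addrC E1.
have -> : w = (0 - (base a + base b * z)) * (base c)^-1.
  apply: (mulIf (b0 _ c0)); rewrite divfK ?b0 // sub0r; apply/eqP.
  by rewrite -addr_eq0 mulrC addrC -[base a]mulr1 E1.
apply: (GM); last exact: GV.
apply: (GB); first by case: zG.
by apply: zmod_setD => //; exact: GM.
Qed.

Lemma opposite_poles_genus : has_genus iota 0.
Proof. exact: rational_genus0 opposite_poles_transc opposite_poles_generate. Qed.

(** The witness 1 + z + ... + z^k has k + 1 distinct monomials, whereas a sum of k units has at most
    k; the powers of z are linearly independent over K. *)
Lemma opposite_poles_not_good k : (0 < k)%N -> exists2 w, integral w &
  ~ exists e : 'I_k -> F, (forall i, unit_x (e i)) /\ w = \sum_(i < k) e i.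
Proof.
move=> k0; exists (\sum_(j < k.+1) z ^+ j).
  by elim/big_ind: _ => // [||j _]; [exact: integral0 | exact: integral_add | exact: integralX].
move=> [e [ue sE]].
have /choice [cn hcn] : forall i, exists cn : K * int, e i = iota cn.1 * z ^ cn.2.
  by move=> i; have [c [n [_ cE]]] := opposite_poles_units (ue i); exists (c, n).
(* Multiplication by z^N clears the negative exponents, so both sides become polynomials in z. *)
pose N := (\sum_(i < k) absz (cn i).2)%N.
have hN i : (absz (cn i).2 <= N)%N by rewrite /N (bigD1 i) //= leq_addr.
pose m i := absz ((cn i).2 + N%:Z).
pose p := \sum_(i < k) (cn i).1 *: 'X^(m i) : {poly K}.
pose q := \sum_(j < k.+1) 'X^(N + j) : {poly K}.
have pq : p = q.
  apply: (@eval_at_inj _ _ iota z opposite_poles_transc).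
  rewrite /p /q !rmorph_sum /=.
  transitivity (z ^+ N * \sum_(i < k) e i).
    rewrite mulr_sumr; apply: eq_bigr => i _.
    rewrite -mul_polyC eval_atM eval_atXn eval_atC eval_atX hcn mulrCA; congr (_ * _).
    rewrite !exprnP -expfzDr //; congr (z ^ _); have := hN i; rewrite /m; lia.
  rewrite -sE mulr_sumr; apply: eq_bigr => j _.
  by rewrite eval_atXn eval_atX exprD.
(* Each of the k + 1 monomials must occur among the k exponents [m i]; choosing one for each gives
   an injection into a smaller set. *)
have /choice [s hs] : forall j : 'I_k.+1, exists i : 'I_k, m i = (N + j)%N.
  move=> j; apply: contrapT => /forallNP h.
  have : p`_(N + j) = q`_(N + j) by rewrite pq.
  rewrite !coef_sum big1 => [|i _]; last first.
    by rewrite coefZ coefXn; case: eqVneq (h i) => [->//|_ _]; rewrite mulr0.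
  rewrite (bigD1 j) //= coefXn eqxx big1 => [|i ij].
    by rewrite addr0 => /esym /eqP; rewrite oner_eq0.
  by rewrite coefXn eqn_add2l; case: eqVneq => // ji; case/eqP: ij; exact: val_inj.
have sinj : injective s.
  by move=> i j sij; apply/val_inj/(@addnI N); rewrite -!hs sij.
by have := leq_card s sinj; rewrite !card_ord ltnn.
Qed.

End OppositePoles.


(** Not all units are algebraic. A unit u that is not algebraic has a pole, and so has its inverse;
    both poles are infinite since u and its inverse are integral, and they differ because a pole of
    u is a zero of the inverse. *)
Lemma generated_opposite_poles : generated ->
  exists P Q z z', opposite_poles P Q z z'.
Proof.
move=> gen.
have [u [hu nu]] : exists u, unit_x u /\ ~ algebraicOver iota u.
  (* The algebraic elements form an additive group; if it contained all units, it would contain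
     x. *)
  apply: contrapT => h; pose S : set F := algebraicOver iota.
  have [||p p0] := gen S _ _ x integral_gen.
  - split; first exact: algebraic0.
    by move=> a b; exact: algebraic_sub.
  - by move=> u hu; apply: contrapT => nu; apply: h; exists u.
  by move=> /rootP pr; have := x_transc p0; rewrite /eval_at pr eqxx.
have [u0 iu iuV] := hu.
have pole w : integral w -> ~ algebraicOver iota w -> exists P, infinite P /\ ~ vring P w.
  move=> iw nw; have nw' : ~ integralOver iota w by move=> /integral_algebraic.
  have [|P [_ nP]] := @place_avoiding _ _ iota _ iota w _ nw'; first by move=> c; exists c.
  by exists P; split=> // /(integral_vring iw).
have [P [hP nP]] := pole u iu nu.
have [|Q [hQ nQ]] := pole _ iuV; first by move=> /algebraic_inv; rewrite invrK.
have nPQ : P <> Q by move=> PQ; apply: nQ; rewrite -PQ; exact/videal_vring/videalV.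
have [z [hz vz]] := unit_simple_pole hP hQ nPQ gen hu nP.
have [z' [hz' vz']] := unit_simple_pole hQ hP (nesym nPQ) gen (unit_xV hu) nQ.
exists P, Q, z, z'; split=> //; have [z0 iz _] := hz; have [z'0 iz' _] := hz'.
split; split=> //.
  by apply: (unit_pole_zero hP hQ nPQ hz); rewrite vz.
by apply: (unit_pole_zero hQ hP (nesym nPQ) hz'); rewrite vz'.
Qed.

(** For D = P - Q of degree 0 the genus inequality reads 1 <= [div_ell D]. The coefficient 1 allows
    at most a simple pole at P, and the coefficient -1 forces a zero at Q. *)
Lemma genus0_simple_pole P Q : infinite P -> infinite Q -> P <> Q -> has_genus iota 0 ->
  exists z, [/\ z != 0, integral z, val_at P z = -1 & videal Q z].
Proof.
move=> hP hQ nPQ [_ genus].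
pose co R : int := if `[< R = P >] then 1 else if `[< R = Q >] then -1 else 0.
have coP : co P = 1 by rewrite /co asboolT.
have coQ : co Q = -1 by rewrite /co asboolF ?asboolT //; exact/nesym.
have co0 R : R <> P -> R <> Q -> co R = 0 by move=> RP RQ; rewrite /co !asboolF.
have cofin : finite_set [set R | co R != 0].
  apply: (@sub_finite_set _ _ [set P; Q]); last exact: finite_set2.
  move=> R /=; apply: contra_neqP => /not_orP [RP RQ]; exact: co0.
pose D := Divisor cofin.
have deg1 R S : infinite R -> infinite S -> R <> S -> place_degree R = 1%N.
  move=> hR hS nRS; apply: place_degree1 => z.
  exact: (two_places_residue F_quadratic base_frac hR hS nRS).
have degD : div_degree D = 0.
  rewrite (@div_degree_seq _ _ _ D [:: P; Q]).
  - rewrite !big_cons big_nil /= coP coQ (deg1 P Q) // (deg1 Q P) //; exact/nesym.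
  - by rewrite /= inE andbT; apply/eqP.
  - move=> R /=; rewrite !inE; apply: contra_neqT; rewrite negb_or => /andP [/eqP ? /eqP ?].
    exact: co0.
have ell0 : (0 < div_ell D)%N by have := genus D; rewrite degD; lia.
have [z Lz z0] := riemann_roch_space_nonzero ell0; have vD := Lz z0.
have dP := discreteP hP hQ nPQ; have dQ := discreteP hQ hP (nesym nPQ).
have iz : integral z.
  (* The bound on [val_at R z] means regularity only because R is discrete. *)
  apply: integral_xP => R hR; have dR := finite_discrete F_quadratic x_transc base_frac hR.
  have RP : R <> P by move=> E1; apply: hP; rewrite -E1.
  have RQ : R <> Q by move=> E1; apply: hQ; rewrite -E1.
  by apply/(val_at_ge0 dR z0); have := vD R; rewrite /= co0 // oppr0.
have Qz : videal Q z by apply/(val_at_gt0 dQ z0); have := vD Q; rewrite /= coQ; lia.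
exists z; split=> //; have := vD P; rewrite /= coP => vP.
apply/eqP; rewrite eq_le vP andbT leNgt; apply/negP => v0.
(* Without a pole at P the element would be a constant that vanishes at Q, hence 0. *)
have Pz : vring P z by apply/(val_at_ge0 dP z0); lia.
have [c cE] := integral_const F_quadratic base_frac hP hQ nPQ iz Pz (videal_vring Qz).
by case/eqP: z0; rewrite cE (videal_const (P := Q) (c := c)) ?rmorph0 // -cE.
Qed.

Lemma genus0_opposite_poles P Q : infinite P -> infinite Q -> P <> Q -> has_genus iota 0 ->
  exists z z', opposite_poles P Q z z'.
Proof.
move=> hP hQ nPQ g0; have [z hz] := genus0_simple_pole hP hQ nPQ g0.
have [z' hz'] := genus0_simple_pole hQ hP (nesym nPQ) g0.
by exists z, z'.
Qed.

Lemma opposite_poles_generated P Q z z' : opposite_poles P Q z z' -> generated.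
Proof.
move=> opp S zS Su; apply: (opposite_poles_span opp zS) => c n c0; apply: Su.
by apply: unit_xM; [exact: unit_x_const | apply: unit_x_expz; exact: opposite_poles_unit opp].
Qed.

End UnitSums.

(** * The extension F of K(x) *)

Lemma rmorphism_eval_at (K E : fieldType) (g : {rmorphism {poly K} -> E})
    (iota : {rmorphism K -> E}) (f : {poly K}) :
  (forall c, g c%:P = iota c) -> g f = eval_at iota (g 'X) f.
Proof.
move=> gC; elim/poly_ind: f => [|f c IH]; first by rewrite rmorph0 eval_at0.
by rewrite rmorphD rmorphM /= IH gC eval_atD eval_atM eval_atX eval_atC.
Qed.

Lemma eq_divf_mul (L : fieldType) (a b c : L) : c != 0 -> a = b / c -> a * c = b.
Proof. by move=> c0 ->; rewrite divfK. Qed.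

Lemma in_alg_base (L : fieldType) (F : fieldExtType L) (a : L) : in_alg F a = base F a.
Proof. by []. Qed.

Section FunctionFieldInstance.
Variables (K : fieldType) (F : fieldExtType {fraction {poly K}}).
Local Notation iota := (ext_const F).
Local Notation O := (ring_of_integers F).

Definition ext_x : F := base F (tofrac 'X).
Local Notation ev := (eval_at iota ext_x).

Lemma base_tofrac (f : {poly K}) : base F (tofrac f) = ev f.
Proof.
apply: (@rmorphism_eval_at _ _ (base F \o @tofrac {poly K}) iota) => c /=.
by rewrite -in_alg_base.
Qed.

Lemma ext_x_transc (f : {poly K}) : f != 0 -> ev f != 0.
Proof. by move=> f0; rewrite -base_tofrac fmorph_eq0 tofrac_eq0. Qed.

Lemma ext_base_frac (a : {fraction {poly K}}) :
  exists f g, g != 0 /\ base F a = ev f / ev g.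
Proof.
have [f [g [g0 ->]]] := fraction_numden a; exists f, g; split=> //.
by rewrite fmorph_div /= !base_tofrac.
Qed.

Lemma integral_xE z :
  integralOver (in_alg F \o @tofrac {poly K}) z <-> integral_x iota ext_x z.
Proof.
have E1 p : map_poly (in_alg F \o @tofrac {poly K}) p = map_poly ev p.
  by apply: eq_map_poly => f; rewrite -base_tofrac.
by split=> -[p mp pz]; exists p => //; rewrite ?E1 // -E1.
Qed.

(** One direction tests the inclusion of maximal ideals on 1/x. In the other, f/g with deg f < deg g
    is a negative power of x times a unit. *)
Lemma lies_over_infinite (Q : place iota) :
  lies_over Q (infinite_place K) <-> infinite ext_x Q.
Proof.
have X0 : (tofrac 'X : {fraction {poly K}}) != 0 by rewrite tofrac_eq0 polyX_eq0.
have baseX0 : base F (tofrac 'X) != 0 by rewrite fmorph_eq0.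
split=> [h hx|nx _ [a ha <-]].
  have mX : videal (infinite_place K) (tofrac 'X)^-1.
    apply/videalP; right; rewrite invrK => -[f [g [g0 sfg E1]]].
    have : tofrac ('X * g) = tofrac f :> {fraction {poly K}}.
      by rewrite tofracM; apply: eq_divf_mul E1; rewrite tofrac_eq0.
    move=> /eqP; rewrite tofrac_eq => /eqP fE; move: sfg.
    by rewrite -fE mulrC size_mulX // ltnn.
  have : videal Q (base F (tofrac 'X)^-1).
    by rewrite -in_alg_base; apply: h; exists (tofrac 'X)^-1.
  by rewrite fmorphV => /(videal_vringV _); rewrite invr_eq0 invrK; apply.
have [f [g [g0 aE]]] := fraction_numden a.
rewrite in_alg_base.
have [->|a0] := eqVneq a 0; first by rewrite rmorph0; exact: videal0.
have f0 : f != 0 by apply: contra_neq a0 => f0; rewrite aE f0 tofrac0 mul0r.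
have sfg : (size f < size g)%N.
  rewrite ltnNge; apply/negP => le; move: ha; rewrite aE => /videalP [/eqP|].
    by rewrite mulf_eq0 invr_eq0 !tofrac_eq0 (negPf f0) (negPf g0).
  by rewrite invf_div; apply; exists g, f.
rewrite aE fmorph_div /= !base_tofrac.
have [u [c [-> c0 hu]]] := eval_at_frac_pole nx f0 g0.
by apply/(infinite_expz _ nx (residue_unit c0 hu)).2; lia.
Qed.

Lemma is_unitP (e : O) : is_unit e <-> unit_x iota ext_x (ic_val e).
Proof.
split=> [[e' [ee' _]]|[e0 ie ieV]].
  have ee : ic_val e * ic_val e' = 1 by have := congr1 val ee'.
  have e0 : ic_val e != 0.
    by apply: contra_eq_neq ee => ->; rewrite mul0r eq_sym oner_eq0.
  have eV : (ic_val e)^-1 = ic_val e' by apply: (mulfI e0); rewrite ee divff.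
  rewrite /unit_x eV.
  by split=> //; apply/integral_xE; [case: (e) | case: (e')] => v /= /asboolP.
have hV : (ic_val e)^-1 \in integral_pred (in_alg F \o @tofrac {poly K}).
  by apply/asboolP/integral_xE.
exists (IntegralClosure hV).
by split; apply: val_inj => /=; [rewrite divff | rewrite mulVf].
Qed.

Lemma ring_of_integersP z : integral_x iota ext_x z -> exists w : O, ic_val w = z.
Proof.
move=> iz; have hz : z \in integral_pred (in_alg F \o @tofrac {poly K}).
  by apply/asboolP/integral_xE.
by exists (IntegralClosure hz).
Qed.

Lemma ic_val_integral (w : O) : integral_x iota ext_x (ic_val w).
Proof. by apply/integral_xE; case: w => v /= /asboolP. Qed.

Lemma generated_by_unitsP : generated_by_units O <-> generated iota ext_x.
Proof.
split=> gen S.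
  move=> [S0 SB] Su w /ring_of_integersP [v <-].
  pose T : {pred O} := [pred v : O | `[< S (ic_val v) >]].
  have /asboolP : v \in T; last by [].
  apply: gen => [|e /is_unitP ue]; last by apply/asboolP/Su.
  split=> [|a b /asboolP ha /asboolP hb]; apply/asboolP; first exact: S0.
  exact: SB.
move=> [S0 SB] Su w.
pose T : set F := [set z | exists2 v : O, v \in S & ic_val v = z].
have [||v vS vE] := gen T _ _ (ic_val w) (ic_val_integral w); last first.
  by have <- : v = w by exact: val_inj.
- move=> u uu; have [_ iu _] := uu; have [v vE] := ring_of_integersP iu.
  by exists v => //; apply/Su/is_unitP; rewrite vE.
- split; first by exists 0.
  by move=> _ _ [a aS <-] [b bS <-]; exists (a - b); rewrite ?SB.
Qed.

Lemma unit_sum_number_omega (R : pzRingType) : unit_sum_number R = UsnOmega <->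
  ~ (exists k, (0 < k)%N /\ good_ring R k) /\ generated_by_units R.
Proof.
rewrite /unit_sum_number; case: pselect => [ex|nex].
  split=> // -[nk _]; case: nk; have [k hk] := ex.
  by exists k; exact: (asboolW hk).
have nk : ~ exists k, (0 < k)%N /\ good_ring R k.
  by move=> [k hk]; apply: nex; exists k; apply/asboolP.
by case: asboolP => [g|g]; split=> // -[].
Qed.

Lemma opposite_poles_omega (F_quadratic : (\dim {: F} = 2)%N) (P Q : place iota) z z' :
  opposite_poles ext_x P Q z z' -> unit_sum_number O = UsnOmega.
Proof.
move=> opp; apply/unit_sum_number_omega; split; last first.
  apply/generated_by_unitsP.
  exact: (opposite_poles_generated F_quadratic ext_base_frac opp).
move=> [k [k0 good]].
have [w iw] := opposite_poles_not_good F_quadratic ext_base_frac opp k0; apply.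
have [v vE] := ring_of_integersP iw; have [e [ue sE]] := good v.
exists (fun i => ic_val (e i)); split=> [i|]; first exact/is_unitP.
by rewrite -vE sE; exact: (raddf_sum val).
Qed.

Lemma opposite_poles_splits (F_quadratic : (\dim {: F} = 2)%N) (P Q : place iota) z z' :
  opposite_poles ext_x P Q z z' -> splits_into_two F (infinite_place K).
Proof.
move=> [[hP hQ nPQ] _]; rewrite /splits_into_two.
have -> : [set R : place iota | lies_over R (infinite_place K)] = [set P; Q].
  apply/seteqP; split=> R /=.
    by move=> /lies_over_infinite /(two_infinite_places F_quadratic ext_base_frac hP hQ nPQ).
  by case=> ->; exact/lies_over_infinite.
apply/eq_cardSP; exists P; first by left.
apply/eq_cardSP; exists Q; first by split; [right | exact/nesym].
have -> : [set P; Q] `\ P `\ Q = set0.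
  by apply/seteqP; split=> R //= [[[->|->] ]].
by rewrite II0 card_eq0.
Qed.

End FunctionFieldInstance.

Theorem theorem2 (K : finFieldType) (F : fieldExtType {fraction {poly K}})
    (F_quadratic : (\dim {: F} = 2)%N) :
  unit_sum_number (ring_of_integers F) = UsnOmega <->
  [/\ full_constant_field (ext_const F), has_genus (ext_const F) 0
    & splits_into_two F (infinite_place K)].
Proof.
split=> [/unit_sum_number_omega [_ /generated_by_unitsP gen]|[_ genus split2]].
  have [P [Q [z [z' opp]]]] :=
    generated_opposite_poles F_quadratic (@ext_x_transc K F) (@ext_base_frac K F) gen.
  have [[hP hQ nPQ] _] := opp; split.
  - by move=> w; exact: (algebraic_const F_quadratic (@ext_base_frac K F) hP hQ nPQ).
  - exact: (opposite_poles_genus F_quadratic (@ext_base_frac K F) opp).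
  - exact: (opposite_poles_splits F_quadratic opp).
have /eq_cardSP [P /lies_over_infinite hP] := split2.
move=> /eq_cardSP [Q [/lies_over_infinite hQ /nesym nPQ] _].
have [z [z' opp]] :=
  genus0_opposite_poles F_quadratic (@ext_x_transc K F) (@ext_base_frac K F) hP hQ nPQ genus.
exact: (opposite_poles_omega F_quadratic opp).
Qed.
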